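(* Let $A$ be a nondegenerate polarized Hopf algebra with $T=\mathrm{Spec}\,A_0$ connected, with a quasitriangular structure $\mathcal R\in A_{\ge0}\hat\otimes A_{\le 0}$, and let $\mathcal O_0\subset\mathcal O$ be a full abelian tensor subcategory which is semisimple and all of whose objects are finite dimensional. Let $E=E(\mathcal O_0)$ and define $\Delta:E\to E\,\widetilde\otimes\,E$ on generators by $$\Delta f(\lambda^1)=f(\lambda^1),\qquad \Delta f(\lambda^2)=f(\lambda^2),\qquad \Delta(L^V)=(L^V)^{12}(L^V)^{13}\quad (f\in M_T,\ V\in Ir),$$ where $\Delta$ acts in the second factor of $L^V\in\mathrm{End}(V)\otimes E$, and $f(\lambda^1),f(\lambda^2)$ on the right are the images of $f$ under the left, respectively right, moment map of $E\,\widetilde\otimes\,E$. Then $\Delta$ preserves the defining relations in $E$.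
   Context: All algebras are over $\mathbb C$. A polarized Hopf algebra is a Hopf algebra $A$ (coproduct, counit $\epsilon$, antipode $S$) such that: (I) $A=\oplus_{k\in\mathbb Z}A[k]$ is $\mathbb Z$-graded; (II) there are graded subalgebras $A_0,A_+,A_-$ such that the multiplication maps $A_+\otimes A_0\otimes A_-\to A$ and $A_-\otimes A_0\otimes A_+\to A$ are isomorphisms of vector spaces, and the graded components of $A_\pm$ are finite dimensional; (III) $\ker\epsilon\cap A_+$ has only elements of positive degree, $\ker\epsilon\cap A_-$ only of negative degree, $A_0$ only of degree zero; (IV) $A_0$ is a commutative cocommutative finitely generated Hopf algebra; (V) $A_{\ge0}=A_0A_+$ and $A_{\le0}=A_0A_-$ are Hopf subalgebras. $T=\mathrm{Spec}\,A_0$ is a commutative affine algebraic group, written additively; its points are characters of $A_0$. $V[\lambda]$ denotes the $\lambda$-weight space of an $A_0$-module. $\chi^\pm_\lambda=\mathbb C v^\pm_\lambda$ is the one-dimensional $A_0A_\pm$-module on which $A_0$ acts by $\lambda$ and $A_\pm$ by $\epsilon$; Verma modules are $M^\pm_\lambda=A\otimes_{A_0A_\pm}\chi^\pm_\lambda$, graded with $\deg v_\lambda^\pm=0$; $(v^\pm_\lambda)^*$ is the degree-zero element of the restricted dual with $\langle (v^\pm_\lambda)^*,v^\pm_\lambda\rangle=1$. $A$ is nondegenerate if $M^\pm_\lambda$ are irreducible for generic $\lambda$ (outside a countable union of lower-dimensional algebraic sets). $\mathcal O$: $\mathbb Z$-graded $A$-modules with grading bounded from above, diagonalizable over $A_0$.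 For $v\in V[\lambda_v]$, $V\in\mathcal O$, generic $\lambda$, $\Phi^v_\lambda:M^+_\lambda\to M^+_{\lambda-\lambda_v}\otimes V$ is the unique $A$-homomorphism with $\langle (v^+_{\lambda-\lambda_v})^*\otimes 1,\Phi^v_\lambda v^+_\lambda\rangle=v$. The fusion matrix $J_{W,V}(\lambda)\in\mathrm{End}(W\otimes V)$ is defined by $J_{W,V}(\lambda)(w\otimes v)=u$ where $(\Phi^w_{\lambda-\lambda_v}\otimes1)\Phi^v_\lambda=\Phi^u_\lambda$; it is invertible and rational in $\lambda$. A quasitriangular structure is an invertible $\mathcal R$ in the completed tensor square $A\hat\otimes A$ (projective limit of $A/I_n\otimes A/I_n$ in each degree, $I_n=A\cdot\oplus_{j\ge n}A[j]$) with $\mathcal R\Delta_A(a)=\Delta_A^{op}(a)\mathcal R$, $(\Delta_A\otimes1)\mathcal R=\mathcal R^{13}\mathcal R^{23}$, $(1\otimes\Delta_A)\mathcal R=\mathcal R^{13}\mathcal R^{12}$, where $\Delta_A$ is the coproduct of $A$. Definition of $E=E(\mathcal O_0)$. Let $Ir$ be the set of (isomorphism classes of) irreducible modules in $\mathcal O_0$, $M_T$ the field of meromorphic functions on $T$. As a vector space $E=M_T\otimes_{\mathbb C}M_T\otimes_{\mathbb C}\bar E$, $\bar E=\oplus_{U\in Ir}U\otimes U^*$. For the trivial module $\mathbb C e$, write $f(\lambda^1)=f\otimes1\otimes e\otimes e^*$ and $f(\lambda^2)=1\otimes f\otimes e\otimes e^*$ for $f\in M_T$. Choose for each $U\in Ir$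 a basis $v^U_i$ homogeneous for $T$ and the $\mathbb Z$-grading, with weights $\omega^U_i\in T$; put $L^U_{ij}=1\otimes1\otimes v^U_i\otimes(v^U_j)^*$ and $L^U=\sum_{i,j}E^U_{ij}\otimes L^U_{ij}\in\mathrm{End}(U)\otimes\bar E$, where $E^U_{ij}v^U_k=\delta_{jk}v^U_i$. An element $f\otimes g\otimes v_i^U\otimes (v_j^U)^*$ is $f(\lambda^1)g(\lambda^2)L^U_{ij}$. The defining relations of the (associative) algebra $E$ are: $f(\lambda^1)$ and $g(\lambda^2)$ commute; $f(\lambda^1)L^U_{ij}=L^U_{ij}f(\lambda^1+\omega^U_i)$, $f(\lambda^2)L^U_{ij}=L^U_{ij}f(\lambda^2+\omega^U_j)$; and, for $V,W\in Ir$, in $\mathrm{End}(W)\otimes\mathrm{End}(V)\otimes E$, $$(L^V)^{23}(L^W)^{13}=\;:(J^{12}_{W,V}(\lambda^1))^{-1}\sum_{U\in Ir}(\tau^U_{W,V})^{12}(\mathrm{Id}_{H^U_{W,V}}\otimes L^U)(\bar\tau^U_{W,V})^{12}J^{12}_{W,V}(\lambda^2):,$$ where $H^U_{W,V}=\mathrm{Hom}_A(U,W\otimes V)$, $\tau^U_{W,V}:H^U_{W,V}\otimes U\to W\otimes V$, $h\otimes u\mapsto h(u)$, $\bar\tau^U_{W,V}:W\otimes V\to H^U_{W,V}\otimes U$ is the projection along the other isotypic components, and $:\ :$ means that in each matrix element all functions of $\lambda^1,\lambda^2$ are placed to the left of the elements $L^U_{ij}$. $A_0$-algebra structure. An $A_0$-algebra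 is an associative unital algebra $B=\oplus_{\alpha,\beta\in T}B_{\alpha\beta}$ ($T$-bigraded) with algebra embeddings $\mu_l,\mu_r:M_T\to B_{00}$ (left and right moment maps) with $\mu_l(f(\lambda))a=a\mu_l(f(\lambda+\alpha))$, $\mu_r(f(\lambda))a=a\mu_r(f(\lambda+\beta))$ for $a\in B_{\alpha\beta}$. $E$ is an $A_0$-algebra with $\mu_l(f)=f(\lambda^1)$, $\mu_r(f)=f(\lambda^2)$, $L^U_{ij}\in E_{\omega^U_i,\omega^U_j}$. The matrix tensor product $B\widetilde\otimes C$ of $A_0$-algebras has $(B\widetilde\otimes C)_{\alpha\delta}=\oplus_\beta B_{\alpha\beta}\otimes_{M_T}C_{\beta\delta}$, where $\otimes_{M_T}$ is the tensor product modulo $\mu_r^B(f)b\otimes c=b\otimes\mu_l^C(f)c$, with product $(b\otimes c)(b'\otimes c')=bb'\otimes cc'$ and moment maps $\mu_l=\mu_l^B\otimes1$, $\mu_r=1\otimes\mu_r^C$. *)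

(* Defs.v *)
From HB Require Import structures.
From mathcomp Require Import all_boot all_order all_algebra.
From mathcomp Require Import boolp classical_sets functions cardinality fsbigop.
From mathcomp Require Import topology normedtype derive.

Set Implicit Arguments.
Unset Strict Implicit.
Unset Printing Implicit Defensive.

Import Order.TTheory GRing.Theory Num.Theory numFieldNormedType.Exports.

Local Open Scope classical_set_scope.
Local Open Scope ring_scope.
Local Open Scope quotient_scope.

Section Tensor.
Variables (K : fieldType) (M N : lmodType K).
Variable bal : (M -> M) -> (N -> N) -> Prop.

Definition scale_formal (k : K) (s : seq (M * N)) : seq (M * N) :=
  [seq (k *: p.1, p.2) | p <- s].

(* The tensor product of [M] and [N] consists of formal sums of pairs (m, n), modulo
   K-bilinearity and φ(m) ⊗ n = m ⊗ ψ(n) for (φ, ψ) in [bal]. *)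
Inductive tens_eq : seq (M * N) -> seq (M * N) -> Prop :=
| tens_eq_refl s : tens_eq s s
| tens_eq_sym s t : tens_eq s t -> tens_eq t s
| tens_eq_trans s t u : tens_eq s t -> tens_eq t u -> tens_eq s u
| tens_eq_cat s s' t t' :
    tens_eq s s' -> tens_eq t t' -> tens_eq (s ++ t) (s' ++ t')
| tens_eq_catC s t : tens_eq (s ++ t) (t ++ s)
| tens_eq_scale k s t :
    tens_eq s t -> tens_eq (scale_formal k s) (scale_formal k t)
| tens_eq_0 n : tens_eq [:: (0, n)] [::]
| tens_eq_addl m m' n : tens_eq [:: (m + m', n)] [:: (m, n); (m', n)]
| tens_eq_addr m n n' : tens_eq [:: (m, n + n')] [:: (m, n); (m, n')]
| tens_eq_scaler k m n : tens_eq [:: (k *: m, n)] [:: (m, k *: n)]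
| tens_eq_bal phi psi m n :
    bal phi psi -> tens_eq [:: (phi m, n)] [:: (m, psi n)].

Definition tens_rel : rel (seq (M * N)) := fun s t => `[< tens_eq s t >].

Lemma tens_rel_equiv : equiv_class_of tens_rel.
Proof.
split.
- by move=> s; apply/asboolP; exact: tens_eq_refl.
- by move=> s t; apply/asboolP/asboolP => ?; exact: tens_eq_sym.
- move=> t s u /asboolP st /asboolP tu; apply/asboolP.
  exact: tens_eq_trans st tu.
Qed.

Canonical tens_equiv := EquivRelPack tens_rel_equiv.

Definition tens := {eq_quot tens_equiv}.
HB.instance Definition _ := EqQuotient.on tens.
HB.instance Definition _ := Choice.on tens.

Lemma pi_tensP s t : \pi_tens s = \pi_tens t <-> tens_eq s t.
Proof.
split=> [/eqmodP/asboolP // | ?]; by apply/eqmodP/asboolP.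
Qed.

Lemma repr_tens s : tens_eq (repr (\pi_tens s)) s.
Proof. by apply/pi_tensP; rewrite reprK. Qed.

Definition tadd (x y : tens) : tens := \pi_tens (repr x ++ repr y).
Definition tscale (k : K) (x : tens) : tens :=
  \pi_tens (scale_formal k (repr x)).

Lemma tadd_pi s t : tadd (\pi_tens s) (\pi_tens t) = \pi_tens (s ++ t).
Proof. by apply/pi_tensP/tens_eq_cat; exact: repr_tens. Qed.
Lemma tscale_pi k s : tscale k (\pi_tens s) = \pi_tens (scale_formal k s).
Proof. by apply/pi_tensP/tens_eq_scale; exact: repr_tens. Qed.

Lemma tens_ind (P : tens -> Prop) :
  (forall s, P (\pi_tens s)) -> forall x, P x.
Proof. by move=> h x; rewrite -(reprK x). Qed.

Lemma taddA : associative tadd.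
Proof.
elim/tens_ind=> s; elim/tens_ind=> t; elim/tens_ind=> u.
by rewrite !tadd_pi seq.catA.
Qed.
Lemma taddC : commutative tadd.
Proof.
elim/tens_ind=> s; elim/tens_ind=> t; rewrite !tadd_pi.
by apply/pi_tensP; exact: tens_eq_catC.
Qed.
Lemma tadd0 : left_id (\pi_tens [::]) tadd.
Proof. by elim/tens_ind=> s; rewrite tadd_pi. Qed.

Lemma scale_formalD k l s : tens_eq (scale_formal (k + l) s)
  (scale_formal k s ++ scale_formal l s).
Proof.
elim: s => [|[m n] s IH] /=; first exact: tens_eq_refl.
rewrite scalerDl; set a := (k *: m, n); set b := (l *: m, n).
apply: (@tens_eq_trans _ ([:: a; b] ++ (scale_formal k s ++ scale_formal l s))).
  by apply: (@tens_eq_cat [:: _] [:: a; b]) => //; exact: tens_eq_addl.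
apply: (@tens_eq_cat [:: a] [:: a]); first exact: tens_eq_refl.
rewrite -[b :: scale_formal l s]cat1s seq.catA.
apply: (@tens_eq_cat (b :: scale_formal k s) (scale_formal k s ++ [:: b])).
  exact: (tens_eq_catC [:: b]).
exact: tens_eq_refl.
Qed.

Lemma scale_formal0 s : tens_eq (scale_formal 0 s) [::].
Proof.
elim: s => [|[m n] s IH] /=; first exact: tens_eq_refl.
rewrite scale0r -cat1s -[[::]]cat0s; apply: tens_eq_cat => //.
exact: tens_eq_0.
Qed.

Lemma scale_formal1 s : scale_formal 1 s = s.
Proof. by elim: s => [|[m n] s IH] //=; rewrite scale1r IH. Qed.

Lemma taddN : left_inverse (\pi_tens [::]) (tscale (-1)) tadd.
Proof.
elim/tens_ind=> s; rewrite tscale_pi tadd_pi; apply/pi_tensP.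
rewrite -{2}(scale_formal1 s).
apply: tens_eq_trans (tens_eq_sym (scale_formalD _ _ _)) _.
by rewrite addNr; exact: scale_formal0.
Qed.

HB.instance Definition _ := GRing.isZmodule.Build tens taddA taddC tadd0 taddN.

Lemma pi_cat s t : \pi_tens (s ++ t) = \pi_tens s + \pi_tens t.
Proof. by rewrite -tadd_pi. Qed.
Lemma pi_nil : \pi_tens [::] = 0. Proof. by []. Qed.

Lemma tscaleA k l x : tscale k (tscale l x) = tscale (k * l) x.
Proof.
elim/tens_ind: x => s; rewrite !tscale_pi; congr \pi_tens.
rewrite /scale_formal -map_comp; apply: eq_map => p /=.
by rewrite scalerA.
Qed.
Lemma tscale1 : left_id 1 tscale.
Proof. by elim/tens_ind=> s; rewrite tscale_pi scale_formal1. Qed.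
Lemma tscaleDr : right_distributive tscale +%R.
Proof.
move=> k; elim/tens_ind=> s; elim/tens_ind=> t.
by rewrite -pi_cat !tscale_pi -pi_cat -map_cat.
Qed.
Lemma tscaleDl x : {morph tscale^~ x : k l / k + l}.
Proof.
move=> k l; elim/tens_ind: x => s; rewrite !tscale_pi -pi_cat.
by apply/pi_tensP; exact: scale_formalD.
Qed.
HB.instance Definition _ :=
  GRing.Zmodule_isLmodule.Build K tens tscaleA tscale1 tscaleDr tscaleDl.

Definition tpure (m : M) (n : N) : tens := \pi_tens [:: (m, n)].

Lemma pi_tensE s : \pi_tens s = \sum_(p <- s) tpure p.1 p.2.
Proof.
elim: s => [|[m n] s IH]; first by rewrite big_nil pi_nil.
by rewrite big_cons -IH -cat1s pi_cat.
Qed.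
Lemma tpureDl m m' n : tpure (m + m') n = tpure m n + tpure m' n.
Proof. rewrite /tpure -pi_cat; apply/pi_tensP; exact: tens_eq_addl. Qed.
Lemma tpureDr m n n' : tpure m (n + n') = tpure m n + tpure m n'.
Proof. rewrite /tpure -pi_cat; apply/pi_tensP; exact: tens_eq_addr. Qed.
Lemma tpureZl k m n : tpure (k *: m) n = k *: tpure m n.
Proof.
by rewrite /tpure; symmetry; exact: (tscale_pi k [:: (m, n)]).
Qed.
Lemma tpureZr k m n : tpure m (k *: n) = k *: tpure m n.
Proof.
rewrite -tpureZl; apply/pi_tensP; apply: tens_eq_sym; exact: tens_eq_scaler.
Qed.
Lemma tpure_bal phi psi m n :
  bal phi psi -> tpure (phi m) n = tpure m (psi n).
Proof. by move=> h; apply/pi_tensP; exact: tens_eq_bal. Qed.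
Lemma tpure0l n : tpure 0 n = 0.
Proof. by rewrite -(scale0r 0) tpureZl scale0r. Qed.
Lemma tpure0r m : tpure m 0 = 0.
Proof. by rewrite -(scale0r 0) tpureZr scale0r. Qed.
Lemma tpureNl m n : tpure (- m) n = - tpure m n.
Proof. by rewrite -scaleN1r tpureZl scaleN1r. Qed.
Lemma tpure_suml I r (P : pred I) F n :
  tpure (\sum_(i <- r | P i) F i) n = \sum_(i <- r | P i) tpure (F i) n.
Proof.
apply: (big_morph (tpure^~ n)) => [m m'|]; [exact: tpureDl|exact: tpure0l].
Qed.
Lemma tpure_sumr I r (P : pred I) F m :
  tpure m (\sum_(i <- r | P i) F i) = \sum_(i <- r | P i) tpure m (F i).
Proof.
apply: (big_morph (tpure m)) => [n n'|]; [exact: tpureDr|exact: tpure0r].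
Qed.

(* Sweedler-style sum: the image of Σ m ⊗ n is Σ f(m, n).  It is computed on a chosen
   representative, hence only meaningful when [bilinear_bal f] holds. *)
Definition tsum (P : lmodType K) (f : M -> N -> P) (x : tens) : P :=
  \sum_(p <- repr x) f p.1 p.2.

Definition bilinear_bal (P : lmodType K) (f : M -> N -> P) :=
  [/\ forall k m m' n, f (k *: m + m') n = k *: f m n + f m' n,
      forall k m n n', f m (k *: n + n') = k *: f m n + f m n' &
      forall phi psi m n, bal phi psi -> f (phi m) n = f m (psi n)].

Section Lift.
Variables (P : lmodType K) (f : M -> N -> P).
Hypothesis hf : bilinear_bal f.

Lemma tens_eq_lift s t : tens_eq s t ->
  \sum_(p <- s) f p.1 p.2 = \sum_(p <- t) f p.1 p.2.
Proof.
have [fl fr fb] := hf.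
have f0 n : f 0 n = 0.
  by have := fl (-1) 0 0 n; rewrite scaler0 addr0 scaleN1r addNr.
have f0r m : f m 0 = 0.
  by have := fr (-1) m 0 0; rewrite scaler0 addr0 scaleN1r addNr.
elim=> //.
- by move=> ? ? ? _ -> _ ->.
- by move=> ? ? ? ? _ e1 _ e2; rewrite !big_cat e1 e2.
- by move=> ? ?; rewrite !big_cat /= addrC.
- move=> k {}s {}t _ e; rewrite !big_map /=.
  have h u : \sum_(p <- u) f (k *: p.1) p.2 = k *: \sum_(p <- u) f p.1 p.2.
    rewrite scaler_sumr; apply: eq_bigr => p _.
    by have := fl k p.1 0 p.2; rewrite f0 !addr0.
  by rewrite !h e.
- by move=> n; rewrite big_seq1 big_nil f0.
- move=> m m' n; rewrite !big_cons !big_nil /= !addr0.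
  by have := fl 1 m m' n; rewrite !scale1r.
- move=> m n n'; rewrite !big_cons !big_nil /= !addr0.
  by have := fr 1 m n n'; rewrite !scale1r.
- move=> k m n; rewrite !big_seq1 /=.
  have := fl k m 0 n; have := fr k m n 0.
  by rewrite f0 f0r !addr0 => -> ->.
- by move=> phi psi m n h; rewrite !big_seq1 /=; exact: fb.
Qed.

Lemma tsum_pi s : tsum f (\pi_tens s) = \sum_(p <- s) f p.1 p.2.
Proof. by apply: tens_eq_lift; exact: repr_tens. Qed.
Lemma tsum_pure m n : tsum f (tpure m n) = f m n.
Proof. by rewrite tsum_pi big_seq1. Qed.
Lemma tsumD x y : tsum f (x + y) = tsum f x + tsum f y.
Proof.
elim/tens_ind: x => s; elim/tens_ind: y => t.
by rewrite -pi_cat !tsum_pi big_cat.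
Qed.
Lemma tsumZ k x : tsum f (k *: x) = k *: tsum f x.
Proof.
elim/tens_ind: x => s; rewrite [k *: _]tscale_pi !tsum_pi big_map scaler_sumr.
have [fl _ _] := hf.
apply: eq_bigr => p _ /=.
have f0 n : f 0 n = 0.
  by have := fl (-1) 0 0 n; rewrite scaler0 addr0 scaleN1r addNr.
by have := fl k p.1 0 p.2; rewrite f0 !addr0.
Qed.
Lemma tsum_linear : linear (tsum f).
Proof. by move=> k x y; rewrite tsumD tsumZ. Qed.
Lemma tsum0 : tsum f 0 = 0.
Proof. by rewrite -pi_nil tsum_pi big_nil. Qed.
Lemma tsum_sum I r (Q : pred I) F :
  tsum f (\sum_(i <- r | Q i) F i) = \sum_(i <- r | Q i) tsum f (F i).
Proof. by apply: (big_morph (tsum f)) => [x y|]; [exact: tsumD|exact: tsum0]. Qed.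
End Lift.

Lemma tens_gen (Q : tens -> Prop) : Q 0 -> (forall x y, Q x -> Q y -> Q (x + y)) ->
  (forall m n, Q (tpure m n)) -> forall x, Q x.
Proof.
move=> Q0 QD Qp; elim/tens_ind => s; rewrite pi_tensE.
by elim/big_ind: _ => // p _; exact: Qp.
Qed.
End Tensor.

Section SeparatingFunctional.
Variables (K : fieldType) (V : lmodType K) (e : V).
Hypothesis e_neq0 : e != 0.

Let good (W : set V) :=
  (forall k x y, W x -> W y -> W (k *: x + y)) /\ ~ W e.

Lemma functional_exists : exists f : V -> K, linear (f : V -> K^o) /\ f e = 1.
Proof.
have g0 : good [set 0].
  by split=> [k x y -> ->|/= /eqP]; rewrite ?scaler0 ?addr0 // (negPf e_neq0).
have [|S [[Wl We] maxS]] := @Zorn_bigcup V good.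
  move=> F gF totF; split=> [k x y [W1 F1 x1] [W2 F2 y2]|[W /gF[_ h] /h]//].
  have [le12|le21] := totF _ _ F1 F2.
    by exists W2 => //; have [h _] := gF _ F2; apply: h => //; exact: le12.
  by exists W1 => //; have [h _] := gF _ F1; apply: h => //; exact: le21.
have W0 : S 0.
  have [S0|/set0P[x Sx]] := eqVneq S set0; last first.
    by have := Wl (-1) _ _ Sx Sx; rewrite scaleN1r addNr.
  exfalso; apply: maxS g0; rewrite S0; split; first exact: sub0set.
  by move=> /(_ 0 erefl).
have dec x : exists k, S (x - k *: e).
  apply: contrapT => nk.
  have gx : good [set y | exists k, S (y - k *: x)].
    split=> [k y z [a Sa] [b Sb]|[k Sk]].
      exists (k * a + b); have := Wl k _ _ Sa Sb; congr S.
      by rewrite scalerBr scalerA scalerDl opprD addrACA.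
    have [k0|k0] := eqVneq k 0.
      by apply: We; move: Sk; rewrite k0 scale0r subr0.
    apply: nk; exists k^-1; have := Wl (- k^-1) _ _ Sk W0; congr S.
    by rewrite addr0 scalerBr scalerA mulNr mulVf // !scaleNr scale1r opprK addrC.
  apply: maxS gx; split=> [y Sy|]; first by exists 0; rewrite scale0r subr0.
  move=> /(_ x) Sx; apply: nk; exists 0; rewrite scale0r subr0; apply: Sx.
  by exists 1; rewrite scale1r subrr.
have uniq x k l : S (x - k *: e) -> S (x - l *: e) -> k = l.
  move=> hk hl; apply/eqP; rewrite -subr_eq0; apply/negPn/negP => kl; apply: We.
  have h : S ((k - l) *: e).
    have := Wl (-1) _ _ hk hl; congr S.
    by rewrite scaleN1r opprB addrA subrK -scalerBl.
  by have := Wl (k - l)^-1 _ _ h W0; rewrite addr0 scalerA mulVf // scale1r.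
have /choice [f hf] := dec.
exists f; split=> [k x y|].
  apply: (uniq (k *: x + y)); first exact: hf.
  have := Wl k _ _ (hf x) (hf y); congr S.
  by rewrite scalerBr scalerA scalerDl opprD addrACA.
by apply: (uniq e); rewrite ?scale1r ?subrr.
Qed.
End SeparatingFunctional.

(* (b ⊗ c) (b' ⊗ c') = bb' ⊗ cc', when this is well defined. *)
Definition tmul (K : fieldType) (B C : algType K) (bal : (B -> B) -> (C -> C) -> Prop)
    (x y : tens bal) : tens bal :=
  tsum (fun b' c' => tsum (fun b c => tpure bal (b * b') (c * c')) x) y.

(* Sums of pure tensors [b ⊗ c] with [mt b c]. *)
Definition tspan (K : fieldType) (M N : lmodType K) (bal : (M -> M) -> (N -> N) -> Prop)
    (mt : M -> N -> Prop) (x : tens bal) : Prop :=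
  exists2 s : seq (M * N), (forall p, p \in s -> mt p.1 p.2) &
    x = \sum_(p <- s) tpure bal p.1 p.2.

Section TensorAlgebra.
Variables (K : fieldType) (B C : algType K).
Variables (bal : (B -> B) -> (C -> C) -> Prop) (mt : B -> C -> Prop).
Hypothesis balM : forall phi psi, bal phi psi ->
  (forall b b', phi (b * b') = phi b * b') /\
  (forall c c', psi (c * c') = psi c * c').
Hypothesis mt_bal : forall b c phi psi, mt b c -> bal phi psi ->
  exists phi' psi', [/\ bal phi' psi', forall b', b * phi b' = phi' (b * b') &
    forall c', c * psi c' = psi' (c * c')].
Hypothesis mt1 : mt 1 1.
Hypothesis mtM : forall b c b' c', mt b c -> mt b' c' -> mt (b * b') (c * c').
Hypothesis mtZ : forall k b c, mt b c -> mt (k *: b) c.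

Local Notation pure := (tpure bal).

Lemma rmul_bil b' c' : bilinear_bal bal (fun b c => pure (b * b') (c * c')).
Proof.
split=> [k m m' n|k m n n'|phi psi m n /[dup] h /balM [e1 e2]].
- by rewrite mulrDl -scalerAl tpureDl tpureZl.
- by rewrite mulrDl -scalerAl tpureDr tpureZr.
- by rewrite -e1 -e2 (tpure_bal _ _ h).
Qed.

Lemma tmul_bil (x : tens bal) : tspan mt x ->
  bilinear_bal bal (fun b' c' => tsum (fun b c => pure (b * b') (c * c')) x).
Proof.
move=> [s hs ->].
have E b' c' : tsum (fun b c => pure (b * b') (c * c'))
    (\sum_(p <- s) pure p.1 p.2) = \sum_(p <- s) pure (p.1 * b') (p.2 * c').
  rewrite (tsum_sum (rmul_bil _ _)); apply: eq_bigr => p _.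
  by rewrite (tsum_pure (rmul_bil _ _)).
split=> [k m m' n|k m n n'|phi psi m n h]; rewrite !E.
- rewrite scaler_sumr -big_split; apply: eq_bigr => p _ /=.
  by rewrite mulrDr -scalerAr tpureDl tpureZl.
- rewrite scaler_sumr -big_split; apply: eq_bigr => p _ /=.
  by rewrite mulrDr -scalerAr tpureDr tpureZr.
- rewrite big_seq [RHS]big_seq; apply: eq_bigr => p /hs hp.
  have [phi' [psi' [h' e1 e2]]] := mt_bal hp h.
  by rewrite e1 e2 (tpure_bal _ _ h').
Qed.

Lemma tmul_pure b c b' c' : mt b c ->
  tmul (pure b c) (pure b' c') = pure (b * b') (c * c').
Proof.
move=> h; rewrite /tmul tsum_pure; last first.
  apply: tmul_bil; exists [:: (b, c)]; first by move=> p /[!inE]/eqP->.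
  by rewrite big_seq1.
by rewrite (tsum_pure (rmul_bil _ _)).
Qed.

Lemma tmulDr (x y z : tens bal) : tspan mt x -> tmul x (y + z) = tmul x y + tmul x z.
Proof. by move=> hx; exact: tsumD (tmul_bil hx) _ _. Qed.
Lemma tmulZr k (x y : tens bal) : tspan mt x -> tmul x (k *: y) = k *: tmul x y.
Proof. by move=> hx; exact: tsumZ (tmul_bil hx) _ _. Qed.
Lemma tmul0r (x : tens bal) : tspan mt x -> tmul x 0 = 0.
Proof. move=> hx; have := tmulZr 0 0 hx. by rewrite !scale0r. Qed.
Lemma tmulDl (x y z : tens bal) : tmul (x + y) z = tmul x z + tmul y z.
Proof.
rewrite /tmul /tsum -big_split; apply: eq_bigr => p _.
exact: (tsumD (rmul_bil _ _)).
Qed.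
Lemma tmulZl k (x y : tens bal) : tmul (k *: x) y = k *: tmul x y.
Proof.
rewrite /tmul {2}/tsum scaler_sumr; apply: eq_bigr => p _.
exact: (tsumZ (rmul_bil _ _)).
Qed.
Lemma tmul0l (x : tens bal) : tmul 0 x = 0.
Proof. by have := tmulZl 0 0 x; rewrite !scale0r. Qed.

Lemma tspan0 : tspan (bal := bal) mt 0.
Proof. by exists [::] => //; rewrite big_nil. Qed.
Lemma tspanD x y : tspan (bal := bal) mt x -> tspan mt y -> tspan mt (x + y).
Proof.
move=> [s hs ->] [t ht ->]; exists (s ++ t); last by rewrite big_cat.
by move=> p; rewrite mem_cat => /orP[/hs|/ht].
Qed.
Lemma tspan_pure b c : mt b c -> tspan mt (pure b c).
Proof.
by move=> h; exists [:: (b, c)]; rewrite ?big_seq1 // => p /[!inE]/eqP->.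
Qed.
Lemma tspanZ k x : tspan (bal := bal) mt x -> tspan mt (k *: x).
Proof.
move=> [s hs ->]; rewrite scaler_sumr; elim: s hs => [|p s IH] hs.
  by rewrite big_nil; exact: tspan0.
rewrite big_cons; apply: tspanD.
  by rewrite -tpureZl; apply: tspan_pure; apply/mtZ/hs; rewrite inE eqxx.
by apply: IH => q qs; apply: hs; rewrite inE qs orbT.
Qed.
Lemma tspan_ind (Q : tens bal -> Prop) : Q 0 ->
  (forall x y, tspan mt x -> tspan mt y -> Q x -> Q y -> Q (x + y)) ->
  (forall b c, mt b c -> Q (pure b c)) -> forall x, tspan mt x -> Q x.
Proof.
move=> Q0 QD Qp x [s hs ->]; elim: s hs => [|p s IH] hs; first by rewrite big_nil.
have hp : mt p.1 p.2 by apply: hs; rewrite inE eqxx.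
have hs' q : q \in s -> mt q.1 q.2 by move=> qs; apply: hs; rewrite inE qs orbT.
rewrite big_cons; apply: QD; [exact: tspan_pure| by exists s | exact: Qp | exact: IH].
Qed.
Lemma tspanM (x y : tens bal) : tspan mt x -> tspan mt y -> tspan mt (tmul x y).
Proof.
move=> hx; elim/tspan_ind; first by rewrite tmul0r //; exact: tspan0.
  by move=> y1 y2 _ _ h1 h2; rewrite tmulDr //; exact: tspanD.
move=> b' c' h'; elim/tspan_ind: x / hx; first by rewrite tmul0l; exact: tspan0.
  by move=> x1 x2 _ _ h1 h2; rewrite tmulDl; exact: tspanD.
by move=> b c h; rewrite tmul_pure //; exact/tspan_pure/mtM.
Qed.

Lemma tmulA (x y z : tens bal) : tspan mt x -> tspan mt y -> tspan mt z ->
  tmul x (tmul y z) = tmul (tmul x y) z.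
Proof.
move=> hx hy hz; elim/tspan_ind: z / hz.
- by rewrite !tmul0r // ?tmul0r //; exact: tspanM.
- move=> z1 z2 _ _ h1 h2; rewrite !tmulDr ?h1 ?h2 //; exact: tspanM.
move=> b3 c3 h3; elim/tspan_ind: y / hy.
- by rewrite !(tmul0l, tmul0r).
- by move=> y1 y2 _ _ h1 h2; rewrite tmulDl !tmulDr // tmulDl h1 h2.
move=> b2 c2 h2; elim/tspan_ind: x / hx.
- by rewrite !tmul0l.
- by move=> x1 x2 _ _ h1 h2'; rewrite !tmulDl h1 h2'.
move=> b c h; rewrite !tmul_pure ?mulrA //; exact: mtM.
Qed.
Lemma tmul1l (x : tens bal) : tspan mt x -> tmul (pure 1 1) x = x.
Proof.
elim/tspan_ind.
- by rewrite tmul0r //; exact: tspan_pure.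
- by move=> y z _ _ h1 h2; rewrite tmulDr ?h1 ?h2 //; exact: tspan_pure.
- by move=> b c _; rewrite tmul_pure // !mul1r.
Qed.
Lemma tmul1r (x : tens bal) : tspan mt x -> tmul x (pure 1 1) = x.
Proof.
elim/tspan_ind.
- by rewrite tmul0l.
- by move=> y z _ _ h1 h2; rewrite tmulDl h1 h2.
- by move=> b c h; rewrite tmul_pure // !mulr1.
Qed.
End TensorAlgebra.

Definition no_bal {M N : Type} : (M -> M) -> (N -> N) -> Prop := fun _ _ => False.

Definition tensC (K : fieldType) (M N : lmodType K) := tens (@no_bal M N).
HB.instance Definition _ K M N := GRing.Lmodule.on (@tensC K M N).
Notation "M ⊗ N" := (tensC M%type N%type) (at level 40, left associativity) : type_scope.
Notation "m ⊗ n" := (@tpure _ _ _ no_bal m n : tensC _ _)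
  (at level 40, left associativity) : ring_scope.

Section PlainTensorAlgebra.
Variables (K : fieldType) (B C : algType K).
Let mtT (b : B) (c : C) := True.
Let hb phi psi : no_bal phi psi ->
  (forall b b' : B, phi (b * b') = phi b * b') /\
  (forall c c' : C, psi (c * c') = psi c * c'). Proof. by []. Qed.
Let hm (b : B) (c : C) phi psi : mtT b c -> no_bal phi psi ->
  exists phi' psi', [/\ no_bal phi' psi', forall b', b * phi b' = phi' (b * b') &
    forall c', c * psi c' = psi' (c * c')]. Proof. by []. Qed.
Let allT (x : B ⊗ C) : tspan mtT x.
Proof.
by elim/tens_gen: x => [|x y|b c]; [exact: tspan0|exact: tspanD|exact: tspan_pure].
Qed.
Let mulA : associative (tmul (bal := @no_bal B C)).
Proof. by move=> x y z; apply: (tmulA hb hm) => //; exact: allT. Qed.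
Let mul1l : left_id (1 ⊗ 1) (tmul (bal := @no_bal B C)).
Proof. by move=> x; apply: (tmul1l hb hm) => //; exact: allT. Qed.
Let mul1r : right_id (1 ⊗ 1) (tmul (bal := @no_bal B C)).
Proof. by move=> x; apply: (tmul1r hb hm) => //; exact: allT. Qed.
Let mulDl : left_distributive (tmul (bal := @no_bal B C)) +%R.
Proof. by move=> x y z; apply: tmulDl. Qed.
Let mulDr : right_distributive (tmul (bal := @no_bal B C)) +%R.
Proof. by move=> x y z; apply: (tmulDr hb hm); exact: allT. Qed.
Let one_neq0 : (1 ⊗ 1 : B ⊗ C) != 0.
Proof.
have [f [fl f1]] := functional_exists (oner_neq0 B).
have [g [gl g1]] := functional_exists (oner_neq0 C).
have fg : bilinear_bal no_bal (fun b c => f b * g c : K^o).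
  split=> [k m m' n|k m n n'|//].
    by rewrite fl mulrDl [_ *: (_ * _)]mulrA.
  by rewrite gl mulrDr [_ *: (_ * _)]mulrCA.
apply/eqP => e; have := tsum_pure fg 1 1.
rewrite e (tsum0 fg) f1 g1 mulr1 => /esym/eqP.
by rewrite (negPf (oner_neq0 K)).
Qed.
HB.instance Definition _ := GRing.Zmodule_isNzRing.Build (B ⊗ C)%type
  mulA mul1l mul1r mulDl mulDr one_neq0.
Let mulAl k (x y : B ⊗ C) : k *: (x * y) = (k *: x) * y.
Proof. by symmetry; apply: tmulZl. Qed.
Let mulAr k (x y : B ⊗ C) : k *: (x * y) = x * (k *: y).
Proof. by symmetry; apply: (tmulZr hb hm); exact: allT. Qed.
HB.instance Definition _ := GRing.Lmodule_isLalgebra.Build K (B ⊗ C)%type mulAl.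
HB.instance Definition _ := GRing.Lalgebra_isAlgebra.Build K (B ⊗ C)%type mulAr.

Lemma mul_pure (b b' : B) (c c' : C) : (b ⊗ c) * (b' ⊗ c') = (b * b') ⊗ (c * c').
Proof. exact: (tmul_pure hb hm). Qed.
End PlainTensorAlgebra.

Section TensorMaps.
Variables (K : fieldType).

Definition tmap (M N M' N' : lmodType K) (f : M -> M') (g : N -> N')
  (x : M ⊗ N) : M' ⊗ N' := tsum (fun m n => f m ⊗ g n) x.

Definition tassoc (M N P : lmodType K) (x : (M ⊗ N) ⊗ P) : M ⊗ (N ⊗ P) :=
  tsum (fun y p => tsum (fun m n => m ⊗ (n ⊗ p)) y) x.

Definition tswap (M N : lmodType K) (x : M ⊗ N) : N ⊗ M :=
  tsum (fun m n => n ⊗ m) x.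

Definition tform (M N : lmodType K) (f : M -> K) (g : N -> K) (x : M ⊗ N) : K :=
  tsum (fun m n => f m * g n : K^o) x.

(* The image of P ⊗ Q in M ⊗ N (over a field, P ⊗ Q embeds in M ⊗ N). *)
Definition subtens (M N : lmodType K) (P : set M) (Q : set N) : set (M ⊗ N) :=
  tspan (bal := no_bal) (fun m n => P m /\ Q n).

Lemma tform_bil (M N : lmodType K) (f : M -> K) (g : N -> K) :
  linear (f : M -> K^o) -> linear (g : N -> K^o) ->
  bilinear_bal no_bal (fun m n => f m * g n : K^o).
Proof.
move=> fl gl; split=> [k m m' n|k m n n'|//].
- by rewrite fl mulrDl [_ *: (_ * _)]mulrA.
- by rewrite gl mulrDr [_ *: (_ * _)]mulrCA.
Qed.

End TensorMaps.

Section Subspaces.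
Variables (K : fieldType) (V : lmodType K).

Definition subspace (W : set V) :=
  W 0 /\ forall k x y, W x -> W y -> W (k *: x + y).

(* V is the direct sum of the subspaces [G i]. *)
Definition direct_sum (I : choiceType) (G : I -> set V) :=
  [/\ forall i, subspace (G i),
      forall v, exists s (x : I -> V),
        (forall i, G i (x i)) /\ v = \sum_(i <- s) x i &
      forall s (x : I -> V), uniq s -> (forall i, G i (x i)) ->
        \sum_(i <- s) x i = 0 -> forall i, i \in s -> x i = 0].

Definition grspan (I : choiceType) (G : I -> set V) (P : I -> Prop) : set V :=
  [set v | exists s (x : I -> V), [/\ forall i, i \in s -> P i,
     forall i, G i (x i) & v = \sum_(i <- s) x i]].

Definition graded_subset (I : choiceType) (G : I -> set V) (W : set V) :=
  forall s (x : I -> V), uniq s -> (forall i, G i (x i)) ->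
    W (\sum_(i <- s) x i) -> forall i, i \in s -> W (x i).

End Subspaces.

Definition tensor_grading (K : fieldType) (V W : lmodType K)
    (G : int -> set V) (G' : int -> set W) (k : int) : set (V ⊗ W) :=
  tspan (bal := no_bal) (fun v w => exists i j, [/\ i + j = k, G i v & G' j w]).

Definition subalgebra (K : fieldType) (A : algType K) (P : set A) :=
  [/\ subspace P, P 1 & forall x y, P x -> P y -> P (x * y)].

(* [antM] and [ant1] are consequences of the other axioms. *)
Record hopf (K : fieldType) (A : algType K) := Hopf {
  cop : {lrmorphism A -> (A ⊗ A)%type};
  cou : {lrmorphism A -> K^o};
  ant : {linear A -> A};
  copA : forall a, tassoc (tmap cop id (cop a)) = tmap id cop (cop a);
  coul : forall a, tsum (fun b c => cou b *: c) (cop a) = a;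
  cour : forall a, tsum (fun b c => cou c *: b) (cop a) = a;
  antl : forall a, tsum (fun b c => ant b * c) (cop a) = cou a *: 1;
  antr : forall a, tsum (fun b c => b * ant c) (cop a) = cou a *: 1;
  antM : forall a b, ant (a * b) = ant b * ant a;
  ant1 : ant 1 = 1
}.

Definition hopf_subalgebra (K : fieldType) (A : algType K) (h : hopf A) (P : set A) :=
  [/\ subalgebra P, forall x, P x -> subtens P P (cop h x) &
      forall x, P x -> P (ant h x)].

Definition mul3 (K : fieldType) (A : algType K) (x : (A ⊗ A) ⊗ A) : A :=
  tsum (fun y c => tsum (fun a b => a * b) y * c) x.

(* The multiplication map P ⊗ Q ⊗ S -> A is bijective; P ⊗ Q ⊗ S is viewed as a
   subspace of A ⊗ A ⊗ A. *)
Definition mul_iso (K : fieldType) (A : algType K) (P Q S : set A) :=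
  (forall a, exists2 x, subtens (subtens P Q) S x & mul3 x = a) /\
  (forall x, subtens (subtens P Q) S x -> mul3 x = 0 -> x = 0).

(* The subspace A_0 P of A, for A_0 embedded in A by [emb]. *)
Definition mul_span (K : fieldType) (A0 A : algType K) (emb : A0 -> A) (P : set A) :
    set A := [set x | exists2 s : seq (A0 * A),
  (forall p, p \in s -> P p.2) & x = \sum_(p <- s) emb p.1 * p.2].

(* The subalgebra A_0 is given as an algebra [pA0] embedded in [pA] by [emb];
   [pol true] is A_+ and [pol false] is A_-. *)
Record polarized_hopf (K : numFieldType) := PolarizedHopf {
  pA :> algType K;
  hA : hopf pA;
  gr : int -> set pA;
  gr_sum : direct_sum gr;
  gr1 : gr 0 1;
  grM : forall k l a b, gr k a -> gr l b -> gr (k + l) (a * b);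
  gr_cop : forall k a, gr k a -> tensor_grading gr gr k (cop hA a);
  gr_cou : forall k a, gr k a -> k != 0 -> cou hA a = 0;
  gr_ant : forall k a, gr k a -> gr k (ant hA a);
  pA0 : comAlgType K;
  hA0 : hopf pA0;
  emb : {lrmorphism pA0 -> pA};
  emb_inj : injective emb;
  emb_cop : forall a, cop hA (emb a) = tmap emb emb (cop hA0 a);
  emb_cou : forall a, cou hA (emb a) = cou hA0 a;
  emb_ant : forall a, ant hA (emb a) = emb (ant hA0 a);
  A0_cocommutative : forall a, tswap (cop hA0 a) = cop hA0 a;
  A0_fingen : exists s : seq pA0, forall W : set pA0, subalgebra W ->
    (forall a, a \in s -> W a) -> forall a, W a;
  pol : bool -> set pA;
  pol_subalgebra : forall e, subalgebra (pol e);
  pol_graded : forall e, graded_subset gr (pol e);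
  pol_mul_iso : forall e, mul_iso (pol e) (range emb) (pol (~~ e));
  pol_fin : forall e k, exists n (b : 'I_n -> pA), forall x, pol e x -> gr k x ->
    exists c : 'I_n -> K, x = \sum_i c i *: b i;
  pol_pos : forall x, pol true x -> cou hA x = 0 -> grspan gr (fun k => 0 < k) x;
  pol_neg : forall x, pol false x -> cou hA x = 0 -> grspan gr (fun k => k < 0) x;
  emb_gr : forall a, gr 0 (emb a);
  borel_hopf : forall e, hopf_subalgebra hA (mul_span emb (pol e))
}.

Section Points.
Variables (K : numFieldType) (H : polarized_hopf K).
Local Notation A0 := (pA0 H).

Record points := Points {
  pt :> A0 -> K;
  pt_linear : linear (pt : A0 -> K^o);
  pt1 : pt 1 = 1;
  ptM : forall a b, pt (a * b) = pt a * pt b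
}.
HB.instance Definition _ := gen_eqMixin points.
HB.instance Definition _ := gen_choiceMixin points.

Lemma pointsP (x y : points) : pt x =1 pt y -> x = y.
Proof.
case: x y => [f fl f1 fM] [g gl g1 gM] /= /funext e.
by case: _ / e gl g1 gM => gl g1 gM; congr Points; exact: Prop_irrelevance.
Qed.

Lemma ptD (x : points) a b : x (a + b) = x a + x b.
Proof. by have := pt_linear x 1 a b; rewrite !scale1r. Qed.
Lemma pt0 (x : points) : x 0 = 0.
Proof. by apply: (addIr (x 0)); rewrite -ptD !add0r. Qed.
Lemma ptZ (x : points) k a : x (k *: a) = k * x a.
Proof. by have := pt_linear x k a 0; rewrite !addr0 pt0 addr0. Qed.

Section Add.
Variables x y : points.
Let f a : K := tform x y (cop (hA0 H) a).
Let bil := tform_bil (pt_linear x) (pt_linear y).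
Let f_linear : linear (f : A0 -> K^o).
Proof. by move=> k a b; rewrite /f linearP /tform (tsum_linear bil). Qed.
Let tformM u v : tform x y (u * v) = tform x y u * tform x y v.
Proof.
elim/tens_gen: u => [|u1 u2 h1 h2|a b].
- by rewrite mul0r /tform (tsum0 bil) mul0r.
- by rewrite mulrDl {1 2}/tform !(tsumD bil) mulrDl -h1 -h2.
elim/tens_gen: v => [|u1 u2 h1 h2|a' b'].
- by rewrite mulr0 /tform (tsum0 bil) mulr0.
- by rewrite mulrDr {1 3}/tform !(tsumD bil) mulrDr -h1 -h2.
by rewrite mul_pure /tform !(tsum_pure bil) !ptM mulrACA.
Qed.
Let f1 : f 1 = 1.
Proof.
rewrite /f rmorph1 /tform.
by rewrite [LHS](tsum_pure bil) !pt1 mulr1.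
Qed.
Let fM a b : f (a * b) = f a * f b.
Proof. by rewrite /f rmorphM tformM. Qed.
Definition points_add := Points f_linear f1 fM.
End Add.

Definition points0 : points.
Proof.
exists (cou (hA0 H)); [exact: linearP|exact: rmorph1|exact: rmorphM].
Defined.

Definition points_opp (x : points) : points.
Proof.
exists (x \o ant (hA0 H)) => [k a b /=||a b /=].
- by rewrite linearP pt_linear.
- by rewrite /= ant1 pt1.
- by rewrite antM ptM mulrC.
Defined.

Lemma points_addA : associative points_add.
Proof.
move=> x y z; apply: pointsP => a /=.
pose bil u v := tform_bil (pt_linear u) (pt_linear v).
have e1 (u : A0 ⊗ A0) : tform x (points_add y z) u =
    tsum (fun m v => x m * tform y z v : K^o) (tmap id (cop (hA0 H)) u).
  have b3 : bilinear_bal no_bal (fun m v => x m * tform y z v : K^o).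
    apply: tform_bil; first exact: pt_linear.
    exact: tsum_linear (bil _ _).
  have b4 : bilinear_bal no_bal (fun m n : A0 => m ⊗ cop (hA0 H) n).
    split=> [k m m' n|k m n n'|//].
      by rewrite tpureDl tpureZl.
    by rewrite linearP tpureDr tpureZr.
  elim/tens_gen: u => [|u1 u2 h1 h2|b c].
  - by rewrite /tmap /tform (tsum0 (bil _ _)) (tsum0 b4) (tsum0 b3).
  - by rewrite /tmap (tsumD b4) (tsumD b3) -h1 -h2 /tform (tsumD (bil _ _)).
  - by rewrite /tmap (tsum_pure b4) (tsum_pure b3) /tform (tsum_pure (bil _ _)).
have e2 (u : A0 ⊗ A0) : tform (points_add x y) z u =
    tsum (fun m v => x m * tform y z v : K^o) (tassoc (tmap (cop (hA0 H)) id u)).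
  have b3 : bilinear_bal no_bal (fun m v => x m * tform y z v : K^o).
    apply: tform_bil; first exact: pt_linear.
    exact: tsum_linear (bil _ _).
  have b4 : bilinear_bal no_bal (fun m n : A0 => cop (hA0 H) m ⊗ n).
    split=> [k m m' n|k m n n'|//].
      by rewrite linearP tpureDl tpureZl.
    by rewrite tpureDr tpureZr.
  have b6 (p : A0) : bilinear_bal no_bal (fun m n : A0 => m ⊗ (n ⊗ p)).
    split=> [k m m' n|k m n n'|//].
      by rewrite tpureDl tpureZl.
    by rewrite tpureDl tpureZl tpureDr tpureZr.
  have b5 : bilinear_bal no_bal
     (fun (y : A0 ⊗ A0) (p : A0) => tsum (fun m n => m ⊗ (n ⊗ p)) y).
    split=> [k m m' n|k m n n'|//]; first exact: tsum_linear.
    elim/tens_gen: m => [|m1 m2 h1 h2|c d].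
    - by rewrite !(tsum0 (b6 _)) scaler0 addr0.
    - by rewrite !(tsumD (b6 _)) h1 h2 scalerDr addrACA.
    - by rewrite !(tsum_pure (b6 _)) tpureDr tpureDr !tpureZr.
  elim/tens_gen: u => [|u1 u2 h1 h2|b c].
  - by rewrite /tassoc /tmap /tform (tsum0 (bil _ _)) (tsum0 b4) (tsum0 b5) (tsum0 b3).
  - rewrite /tassoc /tmap (tsumD b4) (tsumD b5) (tsumD b3) -h1 -h2.
    by rewrite /tform (tsumD (bil _ _)).
  - rewrite /tassoc /tmap (tsum_pure b4) (tsum_pure b5) /tform (tsum_pure (bil _ _)) /=.
    elim/tens_gen: (cop _ b) => [|u1 u2 h1 h2|d e].
    + by rewrite (tsum0 (b6 _)) (tsum0 b3) /tform (tsum0 (bil _ _)) mul0r.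
    + rewrite (tsumD (b6 _)) (tsumD b3) -h1 -h2 /tform (tsumD (bil _ _)).
      by rewrite mulrDl.
    + rewrite (tsum_pure (b6 _)) (tsum_pure b3) /tform !(tsum_pure (bil _ _)).
      by rewrite mulrA.
by rewrite e1 e2 copA.
Qed.

Lemma points_addC : commutative points_add.
Proof.
move=> x y; apply: pointsP => a /=.
rewrite -[in LHS]A0_cocommutative.
pose bil u v := tform_bil (pt_linear u) (pt_linear v).
have b4 : bilinear_bal no_bal (fun m n : A0 => n ⊗ m).
  split=> [k m m' n|k m n n'|//].
    by rewrite tpureDr tpureZr.
  by rewrite tpureDl tpureZl.
elim/tens_gen: (cop _ a) => [|u1 u2 h1 h2|b c].
- by rewrite /tswap (tsum0 b4) /tform !(tsum0 (bil _ _)).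
- rewrite /tswap (tsumD b4) /tform !(tsumD (bil _ _)).
  by congr (_ + _).
- by rewrite /tswap (tsum_pure b4) /tform !(tsum_pure (bil _ _)) mulrC.
Qed.

Lemma points_add0 : left_id points0 points_add.
Proof.
move=> x; apply: pointsP => a /=.
rewrite -[in RHS](coul (hA0 H) a) /=.
pose bil := tform_bil (pt_linear points0) (pt_linear x).
have b4 : bilinear_bal no_bal (fun b c : A0 => cou (hA0 H) b *: c).
  split=> [k m m' n|k m n n'|//].
    by rewrite linearP scalerDl scalerA.
  by rewrite scalerDr !scalerA mulrC.
elim/tens_gen: (cop _ a) => [|u1 u2 h1 h2|b c].
- by rewrite (tsum0 b4) pt0 /tform (tsum0 bil).
- by rewrite (tsumD b4) ptD -h1 -h2 /tform (tsumD bil).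
- by rewrite (tsum_pure b4) ptZ /tform (tsum_pure bil).
Qed.

Lemma points_addN : left_inverse points0 points_opp points_add.
Proof.
move=> x; apply: pointsP => a /=.
have := congr1 x (antl (hA0 H) a); rewrite ptZ pt1 mulr1 => <-.
pose bil := tform_bil (pt_linear (points_opp x)) (pt_linear x).
have b4 : bilinear_bal no_bal (fun b c : A0 => ant (hA0 H) b * c).
  split=> [k m m' n|k m n n'|//].
    by rewrite linearP mulrDl -scalerAl.
  by rewrite mulrDr -scalerAr.
elim/tens_gen: (cop _ a) => [|u1 u2 h1 h2|b c].
- by rewrite (tsum0 b4) pt0 /tform (tsum0 bil).
- by rewrite (tsumD b4) ptD -h1 -h2 /tform (tsumD bil).
- by rewrite (tsum_pure b4) ptM /tform (tsum_pure bil).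
Qed.

HB.instance Definition _ := GRing.isZmodule.Build points
  points_addA points_addC points_add0 points_addN.

Lemma ptDE (x y : points) a : (x + y) a = tform x y (cop (hA0 H) a).
Proof. by []. Qed.
End Points.

Section AnalyticTopology.
Variables (K : numFieldType) (H : polarized_hopf K).
Local Notation A0 := (pA0 H).
Local Notation T := (points H).

(* Neighbourhoods for the complex topology of T, i.e. the coarsest one making
   all the evaluations at elements of A_0 continuous. *)
Definition near_pt (x : T) (P : T -> Prop) := exists2 s : seq (A0 * K),
  (forall p, p \in s -> 0 < p.2) &
  forall y : T, (forall p, p \in s -> `|y p.1 - x p.1| < p.2) -> P y.

Lemma near_ptW x (P Q : T -> Prop) :
  (forall y, P y -> Q y) -> near_pt x P -> near_pt x Q.
Proof. by move=> PQ [s s0 h]; exists s => // y /h/PQ. Qed.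
Lemma near_ptT x (P : T -> Prop) : (forall y, P y) -> near_pt x P.
Proof. by move=> h; exists [::]. Qed.
Lemma near_pt_self x P : near_pt x P -> P x.
Proof. by move=> [s s0]; apply=> p /s0; rewrite subrr normr0. Qed.
Lemma near_ptI x (P Q : T -> Prop) :
  near_pt x P -> near_pt x Q -> near_pt x (fun y => P y /\ Q y).
Proof.
move=> [s s0 hs] [t t0 ht]; exists (s ++ t).
  by move=> p; rewrite mem_cat => /orP[/s0|/t0].
move=> y hy; split; [apply: hs|apply: ht] => p hp; apply: hy;
  by rewrite mem_cat hp ?orbT.
Qed.
Lemma near_pt_open x P : near_pt x P -> near_pt x (fun y => near_pt y P).
Proof.
move=> [s s0 hs]; exists s => // y hy.
exists [seq (p.1, p.2 - `|y p.1 - x p.1|) | p <- s].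
  by move=> _ /mapP[p ps ->] /=; rewrite subr_gt0; exact: hy.
move=> z hz; apply: hs => p ps.
have /= := hz _ (map_f _ ps); rewrite ltrBrDr; apply: le_lt_trans.
have -> : z p.1 - x p.1 = (z p.1 - y p.1) + (y p.1 - x p.1) by rewrite addrA subrK.
exact: ler_normD.
Qed.

Definition coords k (a : 'I_k -> A0) (x : T) : 'rV[K]_k := \row_i x (a i).

Lemma near_pt_coords k (a : 'I_k -> A0) x (Q : set 'rV[K]_k) :
  nbhs (coords a x) Q -> near_pt x (fun y => Q (coords a y)).
Proof.
move=> /nbhs_ballP[e /= e0 hQ]; exists [seq (a i, e) | i <- enum 'I_k].
  by move=> _ /mapP[i _ ->].
move=> y hy; apply: hQ; split=> // i j; rewrite !mxE -ball_normE /= distrC.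
by apply: (hy (a j, e)); apply/mapP; exists j => //; rewrite mem_enum.
Qed.

(* [f] is holomorphic at [x]: near [x] it is the restriction to T of a
   holomorphic function of finitely many regular functions. *)
Definition holomorphic_at (x : T) (f : T -> K) :=
  exists k (a : 'I_k -> A0) (F : 'rV[K]_k -> K),
    (\forall z \near coords a x, differentiable F z) /\
    near_pt x (fun y => f y = F (coords a y)).

Lemma holomorphic_open x f :
  holomorphic_at x f -> near_pt x (fun y => holomorphic_at y f).
Proof.
move=> [k [a [F [dF fF]]]].
have h1 := near_pt_coords (near_join dF).
apply: near_ptW (near_ptI h1 (near_pt_open fF)) => y [dFy fFy].
by exists k, a, F.
Qed.

Lemma holomorphic_cst x c : holomorphic_at x (fun=> c).
Proof.
exists 0%N, (fun=> 0), (fun=> c); split; last exact: near_ptT.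
by apply: (@filterE _ _ (nbhs_filter _)) => z; exact: differentiable_cst.
Qed.

Lemma holomorphic_reg x (a : A0) : holomorphic_at x (fun y => y a).
Proof.
exists 1%N, (fun=> a), (fun z => z 0 0); split; last first.
  by apply: near_ptT => y; rewrite mxE.
by apply: (@filterE _ _ (nbhs_filter _)) => z; exact: differentiable_coord.
Qed.

Definition fcat k l (a : 'I_k -> A0) (b : 'I_l -> A0) (i : 'I_(k + l)) :=
  match fintype.split i with inl j => a j | inr j => b j end.

Lemma lsub_fcat k l (a : 'I_k -> A0) (b : 'I_l -> A0) x :
  lsubmx (coords (fcat a b) x) = coords a x.
Proof. by apply/rowP => i; rewrite !mxE /fcat (unsplitK (inl i)). Qed.
Lemma rsub_fcat k l (a : 'I_k -> A0) (b : 'I_l -> A0) x :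
  rsubmx (coords (fcat a b) x) = coords b x.
Proof. by apply/rowP => i; rewrite !mxE /fcat (unsplitK (inr i)). Qed.

Lemma lsubmx_cont k l : continuous (@lsubmx K 1 k l).
Proof.
move=> z Q /nbhs_ballP[e /= e0 hQ]; apply/nbhs_ballP; exists e => //= w [_ h].
by apply: hQ; split=> // i j; rewrite !mxE; exact: h.
Qed.
Lemma rsubmx_cont k l : continuous (@rsubmx K 1 k l).
Proof.
move=> z Q /nbhs_ballP[e /= e0 hQ]; apply/nbhs_ballP; exists e => //= w [_ h].
by apply: hQ; split=> // i j; rewrite !mxE; exact: h.
Qed.

Lemma holomorphic_op2 (op : K -> K -> K) x f g :
  (forall k (F G : 'rV[K]_k -> K) z, differentiable F z -> differentiable G z ->
     differentiable (fun w => op (F w) (G w)) z) ->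
  holomorphic_at x f -> holomorphic_at x g ->
  holomorphic_at x (fun y => op (f y) (g y)).
Proof.
move=> hop [k [a [F [dF fF]]]] [l [b [G [dG gG]]]].
exists (k + l)%N, (fcat a b), (fun w => op (F (lsubmx w)) (G (rsubmx w))); split.
  have h1 : \forall z \near coords (fcat a b) x, differentiable F (lsubmx z).
    apply: (@lsubmx_cont k l (coords (fcat a b) x) [set z | differentiable F z]).
    by rewrite lsub_fcat.
  have h2 : \forall z \near coords (fcat a b) x, differentiable G (rsubmx z).
    apply: (@rsubmx_cont k l (coords (fcat a b) x) [set z | differentiable G z]).
    by rewrite rsub_fcat.
  apply: (@filterS2 _ _ (nbhs_filter _)) h1 h2 => z d1 d2; apply: hop.
    apply: (@differentiable_comp _ _ _ _ (@lsubmx K 1 k l) F) => //.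
    exact/linear_differentiable/lsubmx_cont.
  apply: (@differentiable_comp _ _ _ _ (@rsubmx K 1 k l) G) => //.
  exact/linear_differentiable/rsubmx_cont.
apply: near_ptW (near_ptI fF gG) => y [-> ->].
by rewrite lsub_fcat rsub_fcat.
Qed.

Lemma holomorphicD x f g : holomorphic_at x f -> holomorphic_at x g ->
  holomorphic_at x (fun y => f y + g y).
Proof. by apply: holomorphic_op2 => k F G z; exact: differentiableD. Qed.
Lemma holomorphicM x f g : holomorphic_at x f -> holomorphic_at x g ->
  holomorphic_at x (fun y => f y * g y).
Proof. by apply: holomorphic_op2 => k F G z; exact: differentiableM. Qed.

Lemma holomorphic_neq0 x f : holomorphic_at x f -> f x != 0 ->
  near_pt x (fun y => f y != 0).
Proof.
move=> [k [a [F [dF fF]]]]; rewrite (near_pt_self fF) => F0.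
have /differentiable_continuous cF := nbhs_singleton dF.
have h : \forall z \near coords a x, F z != 0.
  apply: (cF [set z | z != 0]).
  apply/nbhs_ballP; exists `|F (coords a x)|; rewrite /= ?normr_gt0 //.
  by move=> z /=; rewrite -ball_normE /=; apply: contraTneq => ->; rewrite subr0 ltxx.
by apply: near_ptW (near_ptI fF (near_pt_coords h)) => y [->].
Qed.

Lemma near_pt_shift w x P : near_pt (x + w) P -> near_pt x (fun y => P (y + w)).
Proof.
move=> [s s0 hs].
pose b (a : A0) := tsum (fun u v => w v *: u) (cop (hA0 H) a).
have hb (y : T) a : y (b a) = (y + w) a.
  rewrite /b ptDE.
  pose bil := tform_bil (pt_linear y) (pt_linear w).
  have b4 : bilinear_bal no_bal (fun u v : A0 => w v *: u).
    split=> [k m m' n|k m n n'|//].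
      by rewrite scalerDr !scalerA mulrC.
    by rewrite pt_linear scalerDl scalerA.
  elim/tens_gen: (cop _ a) => [|u1 u2 h1 h2|u v].
  - by rewrite (tsum0 b4) pt0 /tform (tsum0 bil).
  - by rewrite (tsumD b4) ptD h1 h2 /tform (tsumD bil).
  - by rewrite (tsum_pure b4) ptZ /tform (tsum_pure bil) mulrC.
exists [seq (b p.1, p.2) | p <- s].
  by move=> _ /mapP[p /s0 p0 ->].
move=> y hy; apply: hs => p ps.
by have := hy _ (map_f _ ps); rewrite /= !hb.
Qed.

Lemma holomorphic_shift w x f : holomorphic_at (x + w) f ->
  holomorphic_at x (fun y => f (y + w)).
Proof.
move=> [k [a [F [dF fF]]]].
pose b (a : A0) := tsum (fun u v => w v *: u) (cop (hA0 H) a).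
have hb (y : T) c : y (b c) = (y + w) c.
  rewrite /b ptDE.
  pose bil := tform_bil (pt_linear y) (pt_linear w).
  have b4 : bilinear_bal no_bal (fun u v : A0 => w v *: u).
    split=> [l m m' n|l m n n'|//].
      by rewrite scalerDr !scalerA mulrC.
    by rewrite pt_linear scalerDl scalerA.
  elim/tens_gen: (cop _ c) => [|u1 u2 h1 h2|u v].
  - by rewrite (tsum0 b4) pt0 /tform (tsum0 bil).
  - by rewrite (tsumD b4) ptD h1 h2 /tform (tsumD bil).
  - by rewrite (tsum_pure b4) ptZ /tform (tsum_pure bil) mulrC.
have cb y : coords (b \o a) y = coords a (y + w).
  by apply/rowP => i; rewrite !mxE /= hb.
exists k, (b \o a), F; rewrite cb; split=> //.
by apply: near_ptW (near_pt_shift fF) => y ->; rewrite cb.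
Qed.

(* [h] does not vanish identically on any nonempty open subset of some
   neighbourhood of [x]. *)
Definition nonvanishing_at (x : T) (h : T -> K) :=
  near_pt x (fun y => ~ near_pt y (fun z => h z = 0)).

Lemma nonvanishingM x f g : holomorphic_at x f -> nonvanishing_at x f ->
  nonvanishing_at x g -> nonvanishing_at x (fun y => f y * g y).
Proof.
move=> /holomorphic_open hf nf ng.
have h := near_ptI (near_pt_open hf) (near_ptI nf (near_pt_open ng)).
apply: near_ptW h => y [hfy [nfy ngy]] fg0; apply: nfy.
have h' := near_ptI (near_pt_open fg0) (near_ptI ngy hfy).
apply: near_ptW h' => z [fg0z [ngz hfz]].
apply/eqP/negPn/negP => fz0; apply: ngz.
apply: near_ptW (near_ptI fg0z (holomorphic_neq0 hfz fz0)) => u [/eqP].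
by rewrite mulf_eq0 => /orP[->//|/eqP->].
Qed.

(* Functions on T that are meromorphic, their values where the denominators
   vanish being irrelevant. *)
Definition meromorphic (f : T -> K) := forall x, exists g h,
  [/\ holomorphic_at x g, holomorphic_at x h, nonvanishing_at x h &
      near_pt x (fun y => h y != 0 -> f y = g y / h y)].

Lemma nonvanishing_cst x (c : K) : c != 0 -> nonvanishing_at x (fun=> c).
Proof. by move=> c0; apply: near_ptT => y /near_pt_self /eqP; rewrite (negPf c0). Qed.

Lemma meromorphic_hol f : (forall x, holomorphic_at x f) -> meromorphic f.
Proof.
move=> hf x; exists f, (fun=> 1); split=> //; first exact: holomorphic_cst.
  by apply: nonvanishing_cst; exact: oner_neq0.
by apply: near_ptT => y _; rewrite divr1.
Qed.

Lemma meromorphicD f g : meromorphic f -> meromorphic g ->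
  meromorphic (fun y => f y + g y).
Proof.
move=> mf mg x; have [f1 [f2 [h1 h2 n2 e]]] := mf x.
have [g1 [g2 [k1 k2 m2 e']]] := mg x.
exists (fun y => f1 y * g2 y + g1 y * f2 y), (fun y => f2 y * g2 y); split.
- by apply: holomorphicD; exact: holomorphicM.
- exact: holomorphicM.
- exact: nonvanishingM.
apply: near_ptW (near_ptI e e') => y [E E']; rewrite mulf_eq0 negb_or => /andP[a b].
by rewrite E // E' // addf_div.
Qed.
Lemma meromorphicM f g : meromorphic f -> meromorphic g ->
  meromorphic (fun y => f y * g y).
Proof.
move=> mf mg x; have [f1 [f2 [h1 h2 n2 e]]] := mf x.
have [g1 [g2 [k1 k2 m2 e']]] := mg x.
exists (fun y => f1 y * g1 y), (fun y => f2 y * g2 y); split.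
- exact: holomorphicM.
- exact: holomorphicM.
- exact: nonvanishingM.
apply: near_ptW (near_ptI e e') => y [E E']; rewrite mulf_eq0 negb_or => /andP[a b].
by rewrite E // E' // mulf_div.
Qed.
Lemma meromorphic_shift w f : meromorphic f -> meromorphic (fun y => f (y + w)).
Proof.
move=> mf x; have [g [h [hg hh nh e]]] := mf (x + w).
exists (fun y => g (y + w)), (fun y => h (y + w)); split.
- exact: holomorphic_shift.
- exact: holomorphic_shift.
- apply: near_ptW (near_pt_shift nh) => y nhy h0; apply: nhy.
  rewrite -[y](addrK w) in h0.
  by apply: near_ptW (near_pt_shift h0) => z; rewrite subrK.
- exact: near_pt_shift e.
Qed.

Definition mero_fun := {f : T -> K | `[< meromorphic f >]}.
HB.instance Definition _ := gen_eqMixin mero_fun.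
HB.instance Definition _ := gen_choiceMixin mero_fun.

(* Two functions are identified if they agree on a dense open subset of T. *)
Definition mero_eq : rel mero_fun := fun f g =>
  `[< forall x P, near_pt x P ->
        exists y, P y /\ near_pt y (fun z => sval f z = sval g z) >].

Lemma mero_equiv_class : equiv_class_of mero_eq.
Proof.
split.
- move=> f; apply/asboolP => x P /near_pt_self Px; exists x; split=> //.
  exact: near_ptT.
- by move=> f g; apply/asboolP/asboolP => h x P /h[y [Py e]]; exists y; split=> //;
    apply: near_ptW e.
- move=> f g h /asboolP gf /asboolP fh; apply/asboolP => x P /near_pt_open nP.
  have [y [Py e]] := gf x _ nP.
  have [z [[Pz ez] e']] := fh y _ (near_ptI Py (near_pt_open e)).
  exists z; split=> //.
  by apply: near_ptW (near_ptI ez e') => u [-> ->].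
Qed.
Canonical mero_equiv := EquivRelPack mero_equiv_class.

(* The field M_T of meromorphic functions on T (a field if T is connected). *)
Definition mero := {eq_quot mero_equiv}.
HB.instance Definition _ := EqQuotient.on mero.
HB.instance Definition _ := Choice.on mero.

Lemma meroP (f : mero_fun) : meromorphic (sval f).
Proof. by have /asboolP := svalP f. Qed.
Definition mk_mero (f : T -> K) (h : meromorphic f) : mero :=
  \pi_mero (exist _ f (asboolT h)).

Lemma eq_mk_mero f g (hf : meromorphic f) (hg : meromorphic g) :
  (forall x P, near_pt x P -> exists y, P y /\ near_pt y (fun z => f z = g z)) ->
  mk_mero hf = mk_mero hg.
Proof. by move=> h; apply/eqmodP/asboolP. Qed.
Lemma mk_mero_eq f g (hf : meromorphic f) (hg : meromorphic g) :
  mk_mero hf = mk_mero hg ->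
  forall x P, near_pt x P -> exists y, P y /\ near_pt y (fun z => f z = g z).
Proof. by move=> /eqmodP/asboolP. Qed.
Lemma eq_mk_meroW f g (hf : meromorphic f) (hg : meromorphic g) :
  f =1 g -> mk_mero hf = mk_mero hg.
Proof.
move=> e; apply: eq_mk_mero => x P /near_pt_self Px; exists x; split=> //.
exact: near_ptT.
Qed.
Lemma mero_ind (P : mero -> Prop) :
  (forall f (hf : meromorphic f), P (mk_mero hf)) -> forall m, P m.
Proof.
move=> h m; rewrite -(reprK m); have := h _ (meroP (repr m)).
by congr (P (\pi_mero _)); exact: val_inj.
Qed.

Definition mero_op1 (op : (T -> K) -> T -> K)
   (hop : forall f, meromorphic f -> meromorphic (op f)) (m : mero) : mero :=
  mk_mero (hop _ (meroP (repr m))).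
Definition mero_op2 (op : K -> K -> K)
   (hop : forall f g, meromorphic f -> meromorphic g ->
      meromorphic (fun y => op (f y) (g y))) (m n : mero) : mero :=
  mk_mero (hop _ _ (meroP (repr m)) (meroP (repr n))).

Lemma repr_mk_mero f (hf : meromorphic f) x P : near_pt x P ->
  exists y, P y /\ near_pt y (fun z => sval (repr (mk_mero hf)) z = f z).
Proof.
move: x P; have /eqmodP/asboolP // : repr (mk_mero hf) = exist _ f (asboolT hf)
  %[mod mero].
by rewrite reprK.
Qed.

Lemma mero_op2E op hop f g (hf : meromorphic f) (hg : meromorphic g) :
  @mero_op2 op hop (mk_mero hf) (mk_mero hg) = mk_mero (hop _ _ hf hg).
Proof.
apply: eq_mk_mero => x P /near_pt_open nP.
have [y [Py e]] := repr_mk_mero hf nP.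
have [z [[Pz ez] e']] := repr_mk_mero hg (near_ptI Py (near_pt_open e)).
exists z; split=> //.
by apply: near_ptW (near_ptI ez e') => u [-> ->].
Qed.

Definition mero_add := mero_op2 meromorphicD.
Definition mero_mul := mero_op2 meromorphicM.
Definition mero_cst c := mk_mero (meromorphic_hol (holomorphic_cst^~ c)).
Definition mero_scale c := mero_mul (mero_cst c).
Definition mero_reg (a : A0) := mk_mero (meromorphic_hol (holomorphic_reg^~ a)).

Lemma mero_addA : associative mero_add.
Proof.
elim/mero_ind=> f hf; elim/mero_ind=> g hg; elim/mero_ind=> h hh.
by rewrite /mero_add !mero_op2E; apply: eq_mk_meroW => y; rewrite addrA.
Qed.
Lemma mero_addC : commutative mero_add.
Proof.
elim/mero_ind=> f hf; elim/mero_ind=> g hg.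
by rewrite /mero_add !mero_op2E; apply: eq_mk_meroW => y; rewrite addrC.
Qed.
Lemma mero_add0 : left_id (mero_cst 0) mero_add.
Proof.
elim/mero_ind=> f hf.
by rewrite /mero_add !mero_op2E; apply: eq_mk_meroW => y; rewrite add0r.
Qed.
Lemma mero_addN : left_inverse (mero_cst 0) (mero_scale (-1)) mero_add.
Proof.
elim/mero_ind=> f hf.
have -> : mero_scale (-1) (mk_mero hf) = mk_mero (meromorphicM
    (meromorphic_hol (holomorphic_cst^~ (-1))) hf) by exact: mero_op2E.
rewrite /mero_add mero_op2E.
by apply: eq_mk_meroW => y /=; rewrite mulN1r addNr.
Qed.
HB.instance Definition _ := GRing.isZmodule.Build mero
  mero_addA mero_addC mero_add0 mero_addN.

Lemma mero_addE f g (hf : meromorphic f) (hg : meromorphic g) :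
  mk_mero hf + mk_mero hg = mk_mero (meromorphicD hf hg).
Proof. exact: mero_op2E. Qed.

Lemma mero_mulA : associative mero_mul.
Proof.
elim/mero_ind=> f hf; elim/mero_ind=> g hg; elim/mero_ind=> h hh.
by rewrite /mero_mul !mero_op2E; apply: eq_mk_meroW => y; rewrite mulrA.
Qed.
Lemma mero_mulC : commutative mero_mul.
Proof.
elim/mero_ind=> f hf; elim/mero_ind=> g hg.
by rewrite /mero_mul !mero_op2E; apply: eq_mk_meroW => y; rewrite mulrC.
Qed.
Lemma mero_mul1 : left_id (mero_cst 1) mero_mul.
Proof.
elim/mero_ind=> f hf.
by rewrite /mero_mul !mero_op2E; apply: eq_mk_meroW => y; rewrite mul1r.
Qed.
Lemma mero_mulDl : left_distributive mero_mul +%R.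
Proof.
elim/mero_ind=> f hf; elim/mero_ind=> g hg; elim/mero_ind=> h hh.
have M u v (hu : meromorphic u) (hv : meromorphic v) :
  mero_mul (mk_mero hu) (mk_mero hv) = mk_mero (meromorphicM hu hv) by exact: mero_op2E.
rewrite mero_addE !M mero_addE.
by apply: eq_mk_meroW => y /=; rewrite mulrDl.
Qed.
Lemma mero_1neq0 : mero_cst 1 != 0.
Proof.
apply/eqP => /mk_mero_eq /(_ 0 (fun=> True)) [|y [_ /near_pt_self/eqP]].
  exact: near_ptT.
by rewrite oner_eq0.
Qed.
HB.instance Definition _ := GRing.Zmodule_isComNzRing.Build mero
  mero_mulA mero_mulC mero_mul1 mero_mulDl mero_1neq0.

Lemma mero_cstM c d : mero_cst (c * d) = mero_cst c * mero_cst d.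
Proof. by symmetry; rewrite [LHS]mero_op2E; exact: eq_mk_meroW. Qed.
Lemma mero_cstD c d : mero_cst (c + d) = mero_cst c + mero_cst d.
Proof. by rewrite mero_addE; exact: eq_mk_meroW. Qed.
Lemma mero_scaleA c d m : mero_scale c (mero_scale d m) = mero_scale (c * d) m.
Proof. by rewrite /mero_scale mero_cstM; exact: mulrA. Qed.
Lemma mero_scale1 : left_id 1 mero_scale. Proof. exact: mul1r. Qed.
Lemma mero_scaleDr : right_distributive mero_scale +%R.
Proof. by move=> c m n; exact: mulrDr. Qed.
Lemma mero_scaleDl m : {morph mero_scale^~ m : c d / c + d}.
Proof. by move=> c d; rewrite /mero_scale mero_cstD; exact: mulrDl. Qed.
HB.instance Definition _ := GRing.Zmodule_isLmodule.Build K mero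
  mero_scaleA mero_scale1 mero_scaleDr mero_scaleDl.
Lemma mero_scaleAl c (m n : mero) : c *: (m * n) = (c *: m) * n.
Proof. exact: mulrA. Qed.
HB.instance Definition _ := GRing.Lmodule_isLalgebra.Build K mero mero_scaleAl.
HB.instance Definition _ := GRing.Lalgebra_isComAlgebra.Build K mero.

(* mero_shift w f is the function f(λ + w). *)
Definition mero_shift (w : T) : mero -> mero :=
  mero_op1 (op := fun f y => f (y + w)) (@meromorphic_shift w).

Lemma mero_shiftE w f (hf : meromorphic f) :
  mero_shift w (mk_mero hf) = mk_mero (meromorphic_shift w hf).
Proof.
apply: eq_mk_mero => x P nP.
rewrite -[x](addrK w) in nP.
have [y [Py e]] := repr_mk_mero hf (near_pt_shift nP).
exists (y - w); split; first exact: Py.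
apply: (@near_pt_shift w (y - w) (fun u => sval (repr (mk_mero hf)) u = f u)).
by rewrite subrK.
Qed.
End AnalyticTopology.

Section Zariski.
Variables (K : numFieldType) (H : polarized_hopf K).
Local Notation T := (points H).

Definition zariski_closed (Z : set T) := exists I : set (pA0 H),
  Z = [set x : T | forall a, I a -> x a = 0].

Definition connected_points := forall Z1 Z2 : set T,
  zariski_closed Z1 -> zariski_closed Z2 -> Z1 `|` Z2 = setT ->
  Z1 `&` Z2 = set0 -> Z1 = set0 \/ Z2 = set0.

(* All the components of the algebraic group T have the same dimension, so that a
   closed subset is lower-dimensional iff its complement is Zariski-dense. *)
Definition lower_dimensional (Z : set T) := zariski_closed Z /\
  forall Z', zariski_closed Z' -> ~` Z `<=` Z' -> Z' = setT.

Definition generic (P : T -> Prop) := exists Z : nat -> set T,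
  (forall n, lower_dimensional (Z n)) /\ forall x, (forall n, ~ Z n x) -> P x.
End Zariski.

Section Modules.
Variables (K : numFieldType) (H : polarized_hopf K).
Local Notation T := (points H).
Local Notation Delta := (cop (hA H)).
Local Notation eps := (cou (hA H)).

Record amod := Amod {
  mcar :> lmodType K;
  act : H -> mcar -> mcar;
  actP : forall a, linear (act a);
  actPl : forall k a b v, act (k *: a + b) v = k *: act a v + act b v;
  act1 : forall v, act 1 v = v;
  actM : forall a b v, act (a * b) v = act a (act b v)
}.

Definition is_hom (V W : amod) (f : V -> W) :=
  linear f /\ forall a v, f (act a v) = act a (f v).

Definition isomorphic (V W : amod) := exists2 f : V -> W, is_hom f & bijective f.

Definition irreducible (V : amod) := (exists v : V, v <> 0) /\
  forall W : set V, subspace W -> (forall a v, W v -> W (act a v)) ->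
    W = [set 0] \/ W = setT.

Definition weight (V : amod) (x : T) : set V :=
  [set v | forall a : pA0 H, act (emb H a) v = x a *: v].

Section TensorModule.
Variables V W : amod.

Definition tact (u : H ⊗ H) (x : V ⊗ W) : V ⊗ W :=
  tsum (fun b c => tmap (@act V b) (@act W c) x) u.

Let b1 b c : bilinear_bal no_bal (fun (v : V) (w : W) => act b v ⊗ act c w).
Proof.
split=> [k m m' n|k m n n'|//]; first by rewrite actP tpureDl tpureZl.
by rewrite actP tpureDr tpureZr.
Qed.
Let b2 x : bilinear_bal no_bal (fun b c => tmap (@act V b) (@act W c) x).
Proof.
split=> [k m m' n|k m n n'|//]; elim/tens_gen: x => [|x y h1 h2|v w].
- by rewrite /tmap !(tsum0 (b1 _ _)) scaler0 addr0.
- by rewrite /tmap in h1 h2 *; rewrite !(tsumD (b1 _ _)) h1 h2 scalerDr addrACA.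
- by rewrite /tmap !(tsum_pure (b1 _ _)) actPl tpureDl tpureZl.
- by rewrite /tmap !(tsum0 (b1 _ _)) scaler0 addr0.
- by rewrite /tmap in h1 h2 *; rewrite !(tsumD (b1 _ _)) h1 h2 scalerDr addrACA.
- by rewrite /tmap !(tsum_pure (b1 _ _)) actPl tpureDr tpureZr.
Qed.
Lemma tact_pure b c v w : tact (b ⊗ c) (v ⊗ w) = act b v ⊗ act c w.
Proof. by rewrite /tact (tsum_pure (b2 _)) /tmap (tsum_pure (b1 _ _)). Qed.
Lemma tactPl k u1 u2 x : tact (k *: u1 + u2) x = k *: tact u1 x + tact u2 x.
Proof. exact: (tsum_linear (b2 x)). Qed.
Lemma tactP u : linear (tact u).
Proof.
move=> k x y; rewrite /tact /tsum scaler_sumr -big_split; apply: eq_bigr => p _ /=.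
exact: (tsum_linear (b1 _ _)).
Qed.
Let tact0l x : tact 0 x = 0. Proof. exact: (tsum0 (b2 x)). Qed.
Let tactDl u1 u2 x : tact (u1 + u2) x = tact u1 x + tact u2 x.
Proof. exact: (tsumD (b2 x)). Qed.
Let tactDr u x y : tact u (x + y) = tact u x + tact u y.
Proof. by have := tactP u 1 x y; rewrite !scale1r. Qed.
Let tact0r u : tact u 0 = 0.
Proof. by apply: (addIr (tact u 0)); rewrite -tactDr !add0r. Qed.
Let tact1 x : tact 1 x = x.
Proof.
elim/tens_gen: x => [|x y h1 h2|v w]; first exact: tact0r.
  by rewrite tactDr h1 h2.
by rewrite [LHS]tact_pure !act1.
Qed.
Let tactM u1 u2 x : tact (u1 * u2) x = tact u1 (tact u2 x).
Proof.
elim/tens_gen: u1 => [|u u' h1 h2|b c]; first by rewrite mul0r !tact0l.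
  by rewrite mulrDl !tactDl h1 h2.
elim/tens_gen: u2 => [|u u' h1 h2|b' c']; first by rewrite mulr0 !tact0l tact0r.
  by rewrite mulrDr !tactDl tactDr h1 h2.
elim/tens_gen: x => [|x y h1 h2|v w]; first by rewrite !tact0r.
  by rewrite !tactDr h1 h2.
by rewrite mul_pure !tact_pure !actM.
Qed.

Definition tmod : amod.
Proof.
exists (V ⊗ W)%type (fun a => tact (Delta a)) => [a|k a b v|v|a b v].
- exact: tactP.
- by rewrite linearP tactPl.
- by rewrite rmorph1 tact1.
- by rewrite rmorphM tactM.
Defined.
End TensorModule.

Definition trivmod : amod.
Proof.
exists K^o (fun a z => eps a * z) => [a k u v|k a b v|v|a b v].
- by rewrite mulrDr [eps a * (_ *: _)]mulrCA.
- by rewrite linearP mulrDl [_ *: (_ * _)]mulrA.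
- by rewrite rmorph1 mul1r.
- by rewrite rmorphM mulrA.
Defined.

Section Verma.
Variables (e : bool) (x : T).

(* a s ⊗ z = a ⊗ χ(s) z for s = a_0 b in A_0 A_±, with χ(s) = x(a_0) ε(b). *)
Definition verma_bal (phi : H -> H) (psi : K^o -> K^o) := exists a0 b,
  [/\ pol e b, phi = (fun a => a * (emb H a0 * b)) &
      psi = (fun z => x a0 * eps b * z)].

Definition verma_act (a : H) (u : tens verma_bal) : tens verma_bal :=
  tsum (fun b z => tpure verma_bal (a * b) z) u.

Let b1 a : bilinear_bal verma_bal (fun b z => tpure verma_bal (a * b) z).
Proof.
split=> [k m m' n|k m n n'|phi psi m n h].
- by rewrite mulrDr -scalerAr tpureDl tpureZl.
- by rewrite tpureDr tpureZr.
have [a0 [b [_ e1 _]]] := h.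
rewrite -(tpure_bal _ _ h); congr (tpure _ _ _).
by rewrite e1; exact: mulrA.
Qed.

Definition verma : amod.
Proof.
exists (tens verma_bal) verma_act => [a|k a b v|v|a b v].
- exact: (tsum_linear (b1 _)).
- elim/tens_gen: v => [|x1 y h1 h2|v w]; rewrite /verma_act.
  + by rewrite !(tsum0 (b1 _)) scaler0 addr0.
  + by rewrite /verma_act in h1 h2; rewrite !(tsumD (b1 _)) h1 h2 scalerDr addrACA.
  + by rewrite !(tsum_pure (b1 _)) mulrDl -scalerAl tpureDl tpureZl.
- elim/tens_gen: v => [|x1 y h1 h2|v w]; rewrite /verma_act.
  + by rewrite !(tsum0 (b1 _)).
  + by rewrite /verma_act in h1 h2; rewrite !(tsumD (b1 _)) h1 h2.
  + by rewrite !(tsum_pure (b1 _)) mul1r.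
- elim/tens_gen: v => [|x1 y h1 h2|v w]; rewrite /verma_act.
  + by rewrite !(tsum0 (b1 _)).
  + by rewrite /verma_act in h1 h2; rewrite !(tsumD (b1 _)) h1 h2.
  + by rewrite !(tsum_pure (b1 _)) mulrA.
Defined.

Definition vtop : verma := tpure verma_bal 1 1.

(* The degree-zero functional v^* on the Verma module, deg (a ⊗ z) being deg a. *)
Definition is_vtop_dual (f : verma -> K) := [/\ linear (f : verma -> K^o),
  f vtop = 1 & forall k a z, k != 0 -> gr k a -> f (tpure verma_bal a z) = 0].
End Verma.

Definition nondegenerate_hopf := forall e, generic (fun x => irreducible (verma e x)).

(* The operator Φ : M_x^+ -> M_y^+ ⊗ V with leading coefficient v. *)
Definition intertwiner (x y : T) (V : amod) (v : V)
    (Phi : verma true x -> verma true y ⊗ V) :=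
  is_hom (Phi : verma true x -> tmod (verma true y) V) /\
  exists2 f, is_vtop_dual f & tsum (fun m u => f m *: u) (Phi (vtop true x)) = v.

(* J_{W,V}(x)(w ⊗ v) = u, for v and w of weights mu and nu. *)
Definition fusion (x : T) (W : amod) (nu : T) (w : W) (V : amod) (mu : T) (v : V)
    (u : tmod W V) := exists Phiv Phiw,
  [/\ intertwiner v (Phiv : verma true x -> verma true (x - mu) ⊗ V),
      intertwiner w (Phiw : verma true (x - mu) -> verma true (x - mu - nu) ⊗ W) &
      intertwiner u (fun m => tassoc (tmap Phiw id (Phiv m)))].

Section Hom.
Variables U X : amod.

Definition hom_pred : {pred (U -> X)} := fun f => `[< is_hom f >].

Lemma hom_closed : GRing.submod_closed hom_pred.
Proof.
split.
  apply/asboolP; split=> [k u v|a v]; first by rewrite scaler0 addr0.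
  apply: (addIr (act a 0)); rewrite add0r -[X in X + _]scale1r -actP scaler0 !add0r.
  by [].
move=> k f g /asboolP[fl fa] /asboolP[gl ga]; apply/asboolP; split=> [l u v|a v].
  rewrite /= !fctE /= fl gl !scalerDr addrACA !scalerA.
  by rewrite [l * k]mulrC.
by rewrite !fctE fa ga actP.
Qed.
HB.instance Definition _ := GRing.isSubmodClosed.Build K (U -> X) hom_pred hom_closed.

Record homA := HomA { hom_fun :> U -> X; _ : hom_fun \in hom_pred }.
HB.instance Definition _ := [isSub for hom_fun].
HB.instance Definition _ := [Choice of homA by <:].
HB.instance Definition _ := [SubChoice_isSubZmodule of homA by <:].
HB.instance Definition _ := [SubZmodule_isSubLmodule of homA by <:].

Definition isotypic_map (y : homA ⊗ U) : X := tsum (fun (h : homA) u => h u) y.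
End Hom.

Record gmod := Gmod {
  gcar :> amod;
  deg : int -> set gcar;
  deg_sum : direct_sum deg;
  deg_act : forall k l a v, gr k a -> deg l v -> deg (k + l) (act a v)
}.

Definition category_O (V : gmod) :=
  (exists N : int, forall k (v : V), N < k -> deg k v -> v = 0) /\
  (forall v : V, exists2 s : seq V, (forall u, u \in s -> exists x, weight x u) &
     v = \sum_(u <- s) u).

(* A full subcategory, given by its class of objects; morphisms are all the
   A-homomorphisms. *)
Record abelian_tensor_subcategory (O0 : gmod -> Prop) : Prop := {
  sub_O : forall V, O0 V -> category_O V;
  sub_zero : exists2 Z, O0 Z & forall z : Z, z = 0;
  sub_biproduct : forall V W, O0 V -> O0 W -> exists2 X, O0 X &
    exists (i1 : V -> X) (i2 : W -> X) (p1 : X -> V) (p2 : X -> W),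
      [/\ [/\ is_hom i1, is_hom i2, is_hom p1 & is_hom p2],
          cancel i1 p1, cancel i2 p2 & forall x, i1 (p1 x) + i2 (p2 x) = x];
  sub_kernel : forall (V W : gmod) (f : V -> W), O0 V -> O0 W -> is_hom f ->
    exists2 X, O0 X & exists i : X -> V,
      [/\ is_hom i, injective i & range i = [set v | f v = 0]];
  sub_cokernel : forall (V W : gmod) (f : V -> W), O0 V -> O0 W -> is_hom f ->
    exists2 X, O0 X & exists p : W -> X,
      [/\ is_hom p, range p = setT & [set w | p w = 0] = range f];
  sub_unit : exists2 X, O0 X & exists f : trivmod -> X,
    [/\ is_hom f, bijective f & forall z, deg 0 (f z)];
  sub_tensor : forall V W, O0 V -> O0 W -> exists2 X, O0 X &
    exists f : tmod V W -> X, [/\ is_hom f, bijective f &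
      forall k x, tensor_grading (@deg V) (@deg W) k x -> deg k (f x)]
}.

Definition semisimple (O0 : gmod -> Prop) := forall V, O0 V ->
  exists n (S : 'I_n -> gmod) (i : forall k, S k -> V) (p : forall k, V -> S k),
    [/\ forall k, O0 (S k) /\ irreducible (S k),
        forall k, is_hom (i k) /\ is_hom (p k),
        forall k, cancel (i k) (p k),
        forall k l x, k != l -> p k (i l x) = 0 &
        forall v, \sum_k i k (p k v) = v].

Definition finite_dimensional (V : amod) := exists n (b : 'I_n -> V),
  forall v, exists c : 'I_n -> K, v = \sum_i c i *: b i.

(* Representatives of the isomorphism classes of irreducible objects, with
   homogeneous bases [bas] of weights [wt] and dual bases [cobas]. *)
Record irreps (O0 : gmod -> Prop) := Irreps {
  Ir :> choiceType;
  rep : Ir -> gmod;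
  rep_O0 : forall U, O0 (rep U);
  rep_irr : forall U, irreducible (rep U);
  rep_inj : forall U U', isomorphic (rep U) (rep U') -> U = U';
  rep_all : forall V, O0 V -> irreducible V -> exists U, isomorphic V (rep U);
  irr_dim : Ir -> nat;
  bas : forall U, 'I_(irr_dim U) -> rep U;
  cobas : forall U, 'I_(irr_dim U) -> rep U -> K;
  cobas_linear : forall U i, linear (@cobas U i : rep U -> K^o);
  cobasE : forall U i j, @cobas U i (@bas U j) = (i == j)%:R;
  bas_span : forall U v, v = \sum_i @cobas U i v *: @bas U i;
  wt : forall U, 'I_(irr_dim U) -> T;
  bas_wt : forall U i, weight (@wt U i) (@bas U i);
  bas_deg : forall U i, exists k, deg k (@bas U i)
}.
End Modules.

Arguments bas {K H O0 i} U _ : rename.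

Section Quasitriangular.
Variables (K : numFieldType) (H : polarized_hopf K).
Local Notation Delta := (cop (hA H)).

(* I_n = A (⊕_{j >= n} A[j]) *)
Definition Iideal (n : nat) : set H := [set a | exists2 s : seq (H * H),
  (forall p, p \in s -> exists2 j : int, n%:Z <= j & gr j p.2) &
  a = \sum_(p <- s) p.1 * p.2].

(* The kernels of A ⊗ A -> A/I_n ⊗ A/I_n and of its analogue for A ⊗ A ⊗ A. *)
Definition Iideal2 (n : nat) : set (H ⊗ H) :=
  tspan (bal := no_bal) (fun a b => Iideal n a \/ Iideal n b).
Definition Iideal3 (n : nat) : set ((H ⊗ H) ⊗ H) :=
  tspan (bal := no_bal) (fun u b => Iideal2 n u \/ Iideal n b).

(* An element of the completed tensor square, as a compatible sequence of
   representatives of its components in A/I_n ⊗ A/I_n; being taken in each degree,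
   the limit only has elements with finitely many homogeneous components. *)
Definition completed (u : nat -> H ⊗ H) :=
  (forall n m, (n <= m)%N -> Iideal2 n (u m - u n)) /\
  (exists N : int, forall n,
     grspan (tensor_grading (@gr K H) (@gr K H)) (fun k => `|k| <= N) (u n)).

(* The product u v = w: as I_n is only a left ideal, the component of u v of index n
   is the limit in m of u_m v_n. *)
Definition completed_mul (u v w : nat -> H ⊗ H) := forall n,
  exists M, forall m, (M <= m)%N -> Iideal2 n (u m * v n - w n).

Definition tassocV (x : H ⊗ (H ⊗ H)) : (H ⊗ H) ⊗ H :=
  tsum (fun a y => tsum (fun b c => (a ⊗ b) ⊗ c) y) x.

Definition leg12 (x : H ⊗ H) : (H ⊗ H) ⊗ H := x ⊗ 1.
Definition leg13 (x : H ⊗ H) : (H ⊗ H) ⊗ H := tsum (fun a b => (a ⊗ 1) ⊗ b) x.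
Definition leg23 (x : H ⊗ H) : (H ⊗ H) ⊗ H := tsum (fun a b => (1 ⊗ a) ⊗ b) x.

Definition A_ge0 : set H := mul_span (emb H) (pol true).
Definition A_le0 : set H := mul_span (emb H) (pol false).

(* R is a quasitriangular structure belonging to the completion of A_{>=0} ⊗ A_{<=0}. *)
Record quasitriangular_structure (Rm : nat -> H ⊗ H) : Prop := {
  qt_completed : completed Rm;
  qt_borel : forall n, exists2 u, subtens A_ge0 A_le0 u & Iideal2 n (Rm n - u);
  qt_invertible : exists Rinv, [/\ completed Rinv,
    completed_mul Rm Rinv (fun=> 1) & completed_mul Rinv Rm (fun=> 1)];
  qt_cop : forall a n, exists M, forall m, (M <= m)%N ->
    Iideal2 n (Rm m * Delta a - tswap (Delta a) * Rm n);
  qt_copl : forall n, exists M, forall m, (M <= m)%N ->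
    Iideal3 n (tmap Delta id (Rm m) - leg13 (Rm m) * leg23 (Rm n));
  qt_copr : forall n, exists M, forall m, (M <= m)%N ->
    Iideal3 n (tassocV (tmap id Delta (Rm m)) - leg13 (Rm m) * leg12 (Rm n))
}.

Definition quasitriangular := exists Rm, quasitriangular_structure Rm.
End Quasitriangular.

Section MeroShift.
Variables (K : numFieldType) (H : polarized_hopf K).
Lemma mero_shift0 (f : mero H) : mero_shift 0 f = f.
Proof.
elim/mero_ind: f => f hf; rewrite mero_shiftE; apply: eq_mk_meroW => y.
by rewrite addr0.
Qed.
Lemma mero_shiftA v w (f : mero H) : mero_shift v (mero_shift w f) = mero_shift (v + w) f.
Proof.
elim/mero_ind: f => f hf; rewrite !mero_shiftE; apply: eq_mk_meroW => y.
by rewrite addrA.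
Qed.
End MeroShift.

Section DynamicalAlgebras.
Variables (K : numFieldType) (H : polarized_hopf K).
Local Notation T := (points H).
Local Notation MT := (mero H).

Record A0_algebra := A0Algebra {
  a0car :> algType K;
  bigr : T -> T -> set a0car;
  bigr_sum : direct_sum (fun p : T * T => bigr p.1 p.2);
  bigr1 : bigr 0 0 1;
  bigrM : forall a b a' b' x y, bigr a b x -> bigr a' b' y ->
    bigr (a + a') (b + b') (x * y);
  momentl : {lrmorphism MT -> a0car};
  momentr : {lrmorphism MT -> a0car};
  momentl_inj : injective momentl;
  momentr_inj : injective momentr;
  momentl_bigr : forall f, bigr 0 0 (momentl f);
  momentr_bigr : forall f, bigr 0 0 (momentr f);
  momentlE : forall a b x f, bigr a b x ->
    momentl f * x = x * momentl (mero_shift a f);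
  momentrE : forall a b x f, bigr a b x ->
    momentr f * x = x * momentr (mero_shift b f)
}.

Section MatrixTensor.
Variables B C : A0_algebra.

Definition MT_bal (phi : B -> B) (psi : C -> C) := exists f : MT,
  phi = (fun b => momentr B f * b) /\ psi = (fun c => momentl C f * c).

Definition matched (b : B) (c : C) := exists a be de, bigr a be b /\ bigr be de c.

Let balM phi psi : MT_bal phi psi ->
  (forall b b', phi (b * b') = phi b * b') /\
  (forall c c', psi (c * c') = psi c * c').
Proof. by move=> [f [-> ->]]; split=> ? ?; rewrite mulrA. Qed.
Let mt_bal b c phi psi : matched b c -> MT_bal phi psi ->
  exists phi' psi', [/\ MT_bal phi' psi', forall b', b * phi b' = phi' (b * b') &
    forall c', c * psi c' = psi' (c * c')].
Proof.
move=> [al [be [de [hb hc]]]] [f [-> ->]].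
exists (fun b => momentr B (mero_shift (- be) f) * b).
exists (fun c => momentl C (mero_shift (- be) f) * c).
split; first by exists (mero_shift (- be) f).
  by move=> b'; rewrite !mulrA (momentrE _ hb) mero_shiftA addrN mero_shift0.
by move=> c'; rewrite !mulrA (momentlE _ hc) mero_shiftA addrN mero_shift0.
Qed.
Let mt1 : matched 1 1.
Proof. by exists 0, 0, 0; split; exact: bigr1. Qed.
Let mtM b c b' c' : matched b c -> matched b' c' -> matched (b * b') (c * c').
Proof.
move=> [x [y [z [hb hc]]]] [x' [y' [z' [hb' hc']]]].
by exists (x + x'), (y + y'), (z + z'); split; exact: bigrM.
Qed.
Let bigrZ (D : A0_algebra) a b k (x : D) : bigr a b x -> bigr a b (k *: x).
Proof.
have [/(_ (a, b)) /= [h0 h] _ _] := bigr_sum D.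
by move=> hx; have := h k x 0 hx h0; rewrite addr0.
Qed.
Let mtZ k b c : matched b c -> matched (k *: b) c.
Proof. by move=> [x [y [z [hb hc]]]]; exists x, y, z; split=> //; exact: bigrZ. Qed.

Definition matrix_pred : {pred tens MT_bal} := fun x => `[< tspan matched x >].
Lemma matrix_closed : GRing.submod_closed matrix_pred.
Proof.
split; first by apply/asboolP; exact: tspan0.
move=> k x y /asboolP hx /asboolP hy; apply/asboolP/tspanD => //.
exact: (tspanZ mtZ).
Qed.
HB.instance Definition _ :=
  GRing.isSubmodClosed.Build K (tens MT_bal) matrix_pred matrix_closed.

(* The direct sum of the B_{αβ} ⊗_{M_T} C_{βδ}, as a subspace of B ⊗_{M_T} C. *)
Record matrix_tensor := MatrixTensor {
  mt_val :> tens MT_bal; _ : mt_val \in matrix_pred }.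
HB.instance Definition _ := [isSub for mt_val].
HB.instance Definition _ := [Choice of matrix_tensor by <:].
HB.instance Definition _ := [SubChoice_isSubZmodule of matrix_tensor by <:].
HB.instance Definition _ := [SubZmodule_isSubLmodule of matrix_tensor by <:].

Lemma mt_valP (x : matrix_tensor) : tspan matched (mt_val x).
Proof. by case: x => x /= /asboolP. Qed.

(* [b ⊗ c], for a matched pair (b, c); by convention 0 otherwise. *)
Definition mpure (b : B) (c : C) : matrix_tensor := insubd 0 (tpure MT_bal b c).

Lemma mpureE b c : matched b c -> mt_val (mpure b c) = tpure MT_bal b c.
Proof. by move=> h; rewrite insubdK //; apply/asboolP/tspan_pure. Qed.

Lemma mt_mul_subproof (x y : matrix_tensor) :
  tmul (mt_val x) (mt_val y) \in matrix_pred.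
Proof. by apply/asboolP/(tspanM balM mt_bal mtM); exact: mt_valP. Qed.
Definition mt_mul x y := MatrixTensor (mt_mul_subproof x y).

Lemma mt_mulA : associative mt_mul.
Proof.
by move=> x y z; apply: val_inj; apply: (tmulA balM mt_bal mtM); exact: mt_valP.
Qed.
Lemma mt_mul1l : left_id (mpure 1 1) mt_mul.
Proof.
move=> x; apply: val_inj; rewrite /= mpureE //.
by apply: (tmul1l balM mt_bal mt1); exact: mt_valP.
Qed.
Lemma mt_mul1r : right_id (mpure 1 1) mt_mul.
Proof.
move=> x; apply: val_inj; rewrite /= mpureE //.
by apply: (tmul1r balM mt_bal); exact: mt_valP.
Qed.
Lemma mt_mulDl : left_distributive mt_mul +%R.
Proof. by move=> x y z; apply: val_inj; exact: (tmulDl balM). Qed.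
Lemma mt_mulDr : right_distributive mt_mul +%R.
Proof.
by move=> x y z; apply: val_inj; apply: (tmulDr balM mt_bal); exact: mt_valP.
Qed.
HB.instance Definition _ := GRing.Zmodule_isPzRing.Build matrix_tensor
  mt_mulA mt_mul1l mt_mul1r mt_mulDl mt_mulDr.

Lemma mpureM b c b' c' : matched b c -> matched b' c' ->
  mpure b c * mpure b' c' = mpure (b * b') (c * c').
Proof.
move=> h h'; apply: val_inj; rewrite /= !mpureE //; last exact: mtM.
exact: (tmul_pure balM mt_bal).
Qed.

Definition mt_momentl (f : MT) : matrix_tensor := mpure (momentl B f) 1.
Definition mt_momentr (f : MT) : matrix_tensor := mpure 1 (momentr C f).
End MatrixTensor.

Section DefiningRelations.
Variables (O0 : gmod H -> Prop) (I : irreps O0).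
Local Notation bidx W V := ('I_(irr_dim W) * 'I_(irr_dim V))%type.

(* [J W V r s] is the matrix element of J_{W,V} in the bases w_k ⊗ v_i of W ⊗ V. *)
Definition bimatrix := forall W V : I, bidx W V -> bidx W V -> MT.

(* J_{W,V} is rational, with inverse [Jinv W V], and its values at
   generic points are the fusion matrices. *)
Record fusion_matrices (J Jinv : bimatrix) : Prop := {
  fm_inv : forall W V (r s : bidx W V), \sum_t J W V r t * Jinv W V t s = (r == s)%:R;
  fm_invV : forall W V (r s : bidx W V), \sum_t Jinv W V r t * J W V t s = (r == s)%:R;
  fm_val : forall W V, exists num den : bidx W V -> bidx W V -> pA0 H,
    (forall r s, J W V r s * mero_reg (den r s) = mero_reg (num r s)) /\
    generic (fun x : T => (forall r s, x (den r s) != 0) /\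
      forall s : bidx W V,
        fusion x (wt s.1) (bas W s.1) (wt s.2) (bas V s.2)
          (\sum_r (x (num r s) / x (den r s)) *: (bas W r.1 ⊗ bas V r.2)))
}.

Definition projections :=
  forall W V U : I, tmod (rep W) (rep V) -> homA (rep U) (tmod (rep W) (rep V)) ⊗ (rep U).

(* [tb W V U] is the projection of W ⊗ V onto its isotypic component Hom_A(U, W ⊗ V) ⊗ U
   along the other ones. *)
Definition isotypic_projections (tb : projections) := forall W V U,
  [/\ linear (tb W V U), cancel (@isotypic_map K H (rep U) (tmod (rep W) (rep V))) (tb W V U) &
      forall U', U' <> U -> forall y : homA (rep U') (tmod (rep W) (rep V)) ⊗ (rep U'),
        tb W V U (isotypic_map y) = 0].

Definition elem (U : I) (p q : 'I_(irr_dim U)) (u : (rep U)) : (rep U) := cobas q u *: bas U p.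

(* The matrix element at (r, s) of τ^U (Id ⊗ E_pq) \bar τ^U in End(W ⊗ V). *)
Definition isotypic_coef (tb : projections) (W V U : I) (p q : 'I_(irr_dim U))
    (r s : bidx W V) : K :=
  tform (cobas r.1) (cobas r.2)
    (isotypic_map (tmap id (elem p q) (tb W V U (bas W s.1 ⊗ bas V s.2)))).

Definition generators (X : Type) := forall U : I, 'I_(irr_dim U) -> 'I_(irr_dim U) -> X.

(* The relations imposed on the images [mul f] of f(λ^1), [mur f] of f(λ^2) and
   [L U i j] of L^U_ij in a ring X.  A scalar c of K acts through [mul c%:A]. *)
Record E_relations (J Jinv : bimatrix) (tb : projections) (X : pzRingType)
    (mul mur : MT -> X) (L : generators X) : Prop := {
  rel_l1 : mul 1 = 1;
  rel_lD : forall f g, mul (f + g) = mul f + mul g;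
  rel_lM : forall f g, mul (f * g) = mul f * mul g;
  rel_r1 : mur 1 = 1;
  rel_rD : forall f g, mur (f + g) = mur f + mur g;
  rel_rM : forall f g, mur (f * g) = mur f * mur g;
  rel_scalar : forall k : K, mul k%:A = mur k%:A;
  rel_unit : forall U i j, isomorphic (trivmod H) (rep U) -> L U i j = 1;
  rel_comm : forall f g, mul f * mur g = mur g * mul f;
  rel_shiftl : forall f U i j, mul f * L U i j = L U i j * mul (mero_shift (wt i) f);
  rel_shiftr : forall f U i j, mur f * L U i j = L U i j * mur (mero_shift (wt j) f);
  rel_quad : forall (W V : I) (r s : bidx W V),
    L V r.2 s.2 * L W r.1 s.1 =
    \sum_(U \in [set: I]) \sum_r' \sum_s' \sum_p \sum_q
      mul (isotypic_coef tb p q r' s' *: Jinv W V r r') * mur (J W V s' s) * L U p q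
}.

Definition E_index := {U : I & ('I_(irr_dim U) * 'I_(irr_dim U))%type}.

(* E is the algebra E(O_0): as a vector space it is M_T ⊗ M_T ⊗ \bar E, where the L^U_ij
   form a basis of \bar E and f ⊗ g ⊗ L^U_ij is f(λ^1) g(λ^2) L^U_ij. *)
Record is_E (J Jinv : bimatrix) (tb : projections) (E : A0_algebra)
    (L : generators E) : Prop := {
  E_rel : E_relations J Jinv tb (momentl E) (momentr E) L;
  E_span : forall e : E, exists (s : seq E_index) (x : E_index -> MT ⊗ MT),
    e = \sum_(k <- s)
      tsum (fun f g => momentl E f * momentr E g) (x k) * L (tag k) (tagged k).1 (tagged k).2;
  E_free : forall (s : seq E_index) (x : E_index -> MT ⊗ MT), uniq s ->
    \sum_(k <- s)
      tsum (fun f g => momentl E f * momentr E g) (x k) * L (tag k) (tagged k).1 (tagged k).2 = 0 ->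
    forall k, k \in s -> x k = 0;
  E_bigr : forall U i j, bigr (wt i) (wt j) (L U i j)
}.

(* The matrix elements of (L^U)^{12} (L^U)^{13}. *)
Definition Delta_L (E : A0_algebra) (L : generators E) : generators (matrix_tensor E E) :=
  fun U i k => \sum_j mpure (L U i j) (L U j k).

End DefiningRelations.
End DynamicalAlgebras.

(* Main.v *)
(** Let c^U_pq(r,s) be the matrix elements of τ^U (Id ⊗ E_pq) \bar τ^U on W ⊗ V and
    T = Σ_U Σ_pq c^U_pq L^U_pq, so that the quadratic relation of E reads
    L^V_{r2 s2} L^W_{r1 s1} = Σ_{r',s'} J^{-1}_{r r'}(λ^1) J_{s' s}(λ^2) T_{r' s'}.
    In Σ_t (L^V L^W)_{r t} ⊗ (L^V L^W)_{t s} the factors J_{s' t}(λ^2) ⊗ 1 and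
    1 ⊗ J^{-1}_{t r''}(λ^1) meet over M_T, and the sum over t cancels them.  The c^U_pq
    multiply like matrix units, orthogonal for distinct U, whence
    Σ_u T_{r u} ⊗ T_{u s} = Σ_U Σ_pq c^U_pq(r,s) Σ_j L^U_pj ⊗ L^U_jq. *)
Require Import Defs.
From mathcomp Require Import all_boot all_algebra complex reals.
From mathcomp Require Import boolp classical_sets cardinality fsbigop.

Set Implicit Arguments.
Unset Strict Implicit.
Unset Printing Implicit Defensive.

Import GRing.Theory.

Local Open Scope ring_scope.

(* Choosing a nonzero row in each nonzero c_x gives linearly independent vectors. *)
Lemma finite_orthogonal_idempotents (F : fieldType) (X : choiceType) (S : finType)
    (c : X -> S -> S -> F) :
  (forall x r s, \sum_t c x r t * c x t s = c x r s) ->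
  (forall x y r s, x <> y -> \sum_t c x r t * c y t s = 0) ->
  finite_set [set x | exists r s, c x r s <> 0].
Proof.
move=> cM c0; apply: contrapT => /(infinite_set_fset #|S|.+1)[B Bsub szB].
have inB (k : 'I_(size (finmap.enum_fset B))) : exists r, exists s,
    c (tnth (in_tuple (finmap.enum_fset B)) k) r s <> 0.
  exact: (Bsub _ (mem_tnth k (in_tuple (finmap.enum_fset B)))).
have /choice[row nz] := inB.
pose e k := tnth (in_tuple (finmap.enum_fset B)) k.
have e_inj : injective e.
  move=> k l /eqP; rewrite /e !(tnth_nth (e k)) nth_uniq ?finmap.fset_uniq //.
  by move=> /eqP/val_inj.
pose A : 'M[F]_(size (finmap.enum_fset B), #|S|) :=
  \matrix_(k, l) c (e k) (row k) (enum_val l).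
suff fA : row_free A.
  by move: (rank_leq_col A); rewrite (eqP fA) leqNgt szB.
apply: inj_row_free => u uA0; apply/rowP => k; rewrite mxE.
have [s cs] := nz k; apply/eqP; move/eqP: cs; apply: contraNT => uk0.
(* The relation [u *m A = 0], multiplied on the right by the matrix c_{e k}: orthogonality removes
   every row but the k-th, and idempotence leaves u_k c_{e k}(row k, s) = 0. *)
have : \sum_t (\sum_l u 0 l * c (e l) (row l) t) * c (e k) t s = 0.
  apply: big1 => t _; have /rowP/(_ (enum_rank t)) := uA0.
  rewrite !mxE; under eq_bigr do rewrite mxE enum_rankK.
  by move=> ->; rewrite mul0r.
under eq_bigr do rewrite mulr_suml.
rewrite exchange_big /= (bigD1 k) //= [X in _ + X]big1 ?addr0.
  under eq_bigr do rewrite -mulrA.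
  by rewrite -mulr_sumr cM => /eqP; rewrite mulf_eq0 (negPf uk0).
move=> l lk; under eq_bigr do rewrite -mulrA.
rewrite -mulr_sumr c0 ?mulr0 // => /e_inj lk'.
by rewrite lk' eqxx in lk.
Qed.

(** * Linear maps on tensor products *)

Section TensorBasics.
Variables (K : fieldType) (M N M' N' : lmodType K).

Lemma tmap_bilinear (f : M -> M') (g : N -> N') : linear f -> linear g ->
  bilinear_bal no_bal (fun m n => f m ⊗ g n).
Proof.
move=> fl gl; split=> [k m m' n|k m n n'|//].
  by rewrite fl tpureDl tpureZl.
by rewrite gl tpureDr tpureZr.
Qed.

Lemma eq_linear_tens (P : lmodType K) (bal : (M -> M) -> (N -> N) -> Prop)
    (f g : tens bal -> P) : linear f -> linear g ->
  (forall m n, f (tpure bal m n) = g (tpure bal m n)) -> f =1 g.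
Proof.
have l0 (h : tens bal -> P) : linear h -> h 0 = 0.
  by move=> hl; have := hl (-1) 0 0; rewrite scaler0 addr0 scaleN1r addNr.
move=> fl gl fg; elim/tens_gen => [|x y fx fy|//]; first by rewrite !l0.
by have := fl 1 x y; have := gl 1 x y; rewrite !scale1r fx fy => -> ->.
Qed.
End TensorBasics.

(** * Matrix units on the isotypic components of W ⊗ V *)

Section IsotypicCoefficients.
Variables (K : numFieldType) (H : polarized_hopf K) (O0 : gmod H -> Prop).
Variables (I : irreps O0) (tb : projections I).
Hypothesis projtb : isotypic_projections tb.

Lemma isotypic_bilinear (U X : amod H) :
  bilinear_bal no_bal (fun (h : homA U X) (u : U) => h u).
Proof.
split=> [//|k h u u'|//].
by case: h => h /= /asboolP[-> _].
Qed.

Lemma isotypic_map_linear (U X : amod H) : linear (@isotypic_map K H U X).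
Proof. exact: tsum_linear (isotypic_bilinear U X). Qed.

Lemma elem_linear (U : I) (p q : 'I_(irr_dim U)) : linear (elem p q).
Proof. by move=> k u v; rewrite /elem cobas_linear scalerDl scalerA. Qed.

Lemma elem_comp (U : I) (p q p' q' : 'I_(irr_dim U)) (u : rep U) :
  elem p q (elem p' q' u) = (q == p')%:R *: elem p q' u.
Proof.
(* Adding 0 gives the argument the shape k x + y in which linearity is stated. *)
rewrite /elem -[_ *: bas U p']addr0 cobas_linear cobasE.
have -> : cobas q (0 : rep U) = 0.
  by have := cobas_linear q (-1) 0 0; rewrite scaler0 addr0 scaleN1r addNr.
by rewrite addr0 scalerA mulrC.
Qed.

Section Product.
Variables W V : I.
Local Notation WV := (tmod (rep W) (rep V)).
Local Notation WVi := ('I_(irr_dim W) * 'I_(irr_dim V))%type.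
Local Notation pbas s := (bas W s.1 ⊗ bas V s.2 : WV).

(** The operator with matrix entries [isotypic_coef]; sums of products of coefficients become
    compositions of such operators. *)
Definition isotypic_elem (U : I) (p q : 'I_(irr_dim U)) (x : WV) : WV :=
  isotypic_map (tmap id (elem p q) (@tb W V U x)).

Let id_elem_bilinear (U : I) (p q : 'I_(irr_dim U)) :
  bilinear_bal no_bal (fun (h : homA (rep U) WV) (u : rep U) => h ⊗ elem p q u).
Proof. by apply: (tmap_bilinear (f := id)) => //; exact: elem_linear. Qed.

Lemma isotypic_elem_linear (U : I) (p q : 'I_(irr_dim U)) : linear (isotypic_elem p q).
Proof.
have [tbl _ _] := projtb W V U; move=> k x y; rewrite /isotypic_elem tbl /tmap.
by rewrite (tsum_linear (id_elem_bilinear p q)) isotypic_map_linear.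
Qed.

(** The inner \bar τ τ is the identity of Hom_A(U, W ⊗ V) ⊗ U, so only the product of two matrix
    units on U remains. *)
Lemma isotypic_elem_comp (U : I) (p q p' q' : 'I_(irr_dim U)) (x : WV) :
  isotypic_elem p q (isotypic_elem p' q' x) = (q == p')%:R *: isotypic_elem p q' x.
Proof.
have [_ tbK _] := projtb W V U; rewrite /isotypic_elem tbK.
have := isotypic_map_linear (q == p')%:R (tmap id (elem p q') (@tb W V U x)) 0.
have -> : isotypic_map (0 : homA (rep U) WV ⊗ rep U) = 0.
  exact: tsum0 (isotypic_bilinear _ _).
rewrite !addr0 => <-; congr isotypic_map.
pose l p q := tsum_linear (@id_elem_bilinear U p q).
move: {x tbK}(@tb W V U x).
apply: eq_linear_tens => [k x y|k x y|h u].
- by rewrite /tmap !l.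
- by rewrite /tmap l scalerDr !scalerA mulrC.
- by rewrite /tmap !(tsum_pure (id_elem_bilinear _ _)) elem_comp tpureZr.
Qed.

(** The inner \bar τ^U annihilates the image of τ^{U'}. *)
Lemma isotypic_elem_orth (U U' : I) (p q : 'I_(irr_dim U)) (p' q' : 'I_(irr_dim U'))
  (x : WV) : U <> U' -> isotypic_elem p q (isotypic_elem p' q' x) = 0.
Proof.
move=> UU'; have [_ _ tb0] := projtb W V U.
rewrite /isotypic_elem tb0; last by move=> e; apply: UU'.
rewrite /tmap (tsum0 (id_elem_bilinear _ _)).
exact: tsum0 (isotypic_bilinear _ _).
Qed.

Let coord_bilinear (r : WVi) :=
  tform_bil (cobas_linear r.1) (cobas_linear r.2).

Let coord (r : WVi) (x : WV) : K :=
  tform (cobas r.1) (cobas r.2) x.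

Let coord_linear r : linear (coord r : WV -> K^o).
Proof. exact: tsum_linear (coord_bilinear r). Qed.

Lemma tensor_bas_span (x : WV) :
  x = \sum_r tform (cobas r.1) (cobas r.2) x *: pbas r.
Proof.
move: x; apply: eq_linear_tens => [//|k x y|w v].
  rewrite scaler_sumr -big_split; apply: eq_bigr => r _ /=.
  by rewrite -/(coord r _) coord_linear scalerDl scalerA.
rewrite {1}(bas_span w) {1}(bas_span v) tpure_suml.
under eq_bigr do rewrite tpure_sumr.
rewrite pair_bigA; apply: eq_bigr => r _ /=.
by rewrite tpureZl tpureZr scalerA /tform (tsum_pure (coord_bilinear r)).
Qed.

(** A product of matrices is the matrix of the composite: the inner vector is expanded in the
    product basis of W ⊗ V. *)
Lemma isotypic_coef_comp (U U' : I) (p q : 'I_(irr_dim U)) (p' q' : 'I_(irr_dim U')) (r s : WVi) :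
  \sum_t isotypic_coef tb p q r t * isotypic_coef tb p' q' t s =
  coord r (isotypic_elem p q (isotypic_elem p' q' (pbas s))).
Proof.
rewrite [X in isotypic_elem p q X]tensor_bas_span.
have fl : linear (fun x => coord r (isotypic_elem p q x) : K^o).
  by move=> k x y; rewrite isotypic_elem_linear coord_linear.
have f0 : coord r (isotypic_elem p q 0) = 0.
  by have := fl (-1) 0 0; rewrite scaler0 addr0 scaleN1r addNr.
rewrite (big_morph (fun x => coord r (isotypic_elem p q x)) (id1 := 0) (op1 := +%R)) //.
  apply: eq_bigr => t _; rewrite mulrC.
  by have := fl (isotypic_coef tb p' q' t s) (pbas t) 0; rewrite !addr0 f0 addr0 => ->.
by move=> x y; have := fl 1 x y; rewrite !scale1r.
Qed.

Lemma isotypic_coefM (U : I) (p q p' q' : 'I_(irr_dim U)) (r s : WVi) :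
  \sum_t isotypic_coef tb p q r t * isotypic_coef tb p' q' t s =
  (q == p')%:R * isotypic_coef tb p q' r s.
Proof.
rewrite isotypic_coef_comp isotypic_elem_comp.
have := coord_linear r (q == p')%:R (isotypic_elem p q' (pbas s)) 0.
have -> : coord r 0 = 0 by exact: tsum0 (coord_bilinear r).
by rewrite !addr0.
Qed.

Lemma isotypic_coef_orth (U U' : I) (p q : 'I_(irr_dim U)) (p' q' : 'I_(irr_dim U')) (r s : WVi) :
  U <> U' -> \sum_t isotypic_coef tb p q r t * isotypic_coef tb p' q' t s = 0.
Proof.
move=> UU'; rewrite isotypic_coef_comp isotypic_elem_orth //.
exact: tsum0 (coord_bilinear r).
Qed.

(* The infinite sum over Ir in the quadratic relation is [\sum_(U \in setT)], which is 0
   when its support is infinite. *)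
Lemma isotypic_coef_finite : exists2 D : seq I, uniq D & forall U, U \notin D ->
  forall (p q : 'I_(irr_dim U)) (r s : WVi), isotypic_coef tb p q r s = 0.
Proof.
(* The diagonal units c^U_pp, indexed by the pairs (U, p), are mutually orthogonal idempotents. *)
pose X := {U : I & 'I_(irr_dim U)}.
pose c (x : X) (r s : WVi) := isotypic_coef tb (tagged x) (tagged x) r s.
have /finite_seqP[S defS] : finite_set [set x : X | exists r s, c x r s <> 0].
  apply: finite_orthogonal_idempotents => [x r s|[U p] [U' p'] r s UU'].
    by rewrite /c isotypic_coefM eqxx mul1r.
  rewrite /c /=; have [eU|nU] := pselect (U = U'); last exact: isotypic_coef_orth.
  subst U'; rewrite isotypic_coefM; case: eqP => [pp'|_]; last by rewrite mul0r.
  by case: UU'; rewrite pp'.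
exists (undup [seq tag x | x <- S]) => [|U]; first exact: undup_uniq.
rewrite mem_undup => US p q r s.
have cpp (r' t : WVi) : isotypic_coef tb p p r' t = 0.
  apply: contrapT => nz; case/negP: US; apply/mapP.
  exists (Tagged (fun U : I => 'I_(irr_dim U)) p) => //.
  have : [set` S]%classic (Tagged (fun U : I => 'I_(irr_dim U)) p).
    by rewrite -defS; exists r', t.
  by [].
(* As c_pq = c_pp c_pq, a vanishing diagonal unit forces its whole row of units to vanish. *)
have := isotypic_coefM p p p q r s; rewrite eqxx mul1r => <-.
by apply: big1 => t _; rewrite cpp mul0r.
Qed.
End Product.

(** The identity matrix factors as g(bas k) cobas_l(f 1), of rank one; a zero off the diagonal would
    kill a factor of some diagonal entry. This makes the sum in [Delta_L] a single term for trivial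
    U. *)
Lemma trivial_irr_dim (U : I) (i j : 'I_(irr_dim U)) :
  isomorphic (trivmod H) (rep U) -> i = j.
Proof.
move=> [f [fl _] [g _ fK]]; apply/eqP; apply: contrapT => /negP ij.
have bE k l : (l == k)%:R = g (bas U k) * cobas l (f 1) :> K.
  rewrite -cobasE -{1}[bas U k]fK.
  have := fl (g (bas U k)) 1 0.
  have f0 : f 0 = 0 by have := fl (-1) 0 0; rewrite scaler0 addr0 scaleN1r addNr.
  rewrite f0 !addr0 [_ *: 1]mulr1 => ->.
  have := cobas_linear l (g (bas U k)) (f 1) 0.
  have -> : cobas l (0 : rep U) = 0.
    by have := cobas_linear l (-1) 0 0; rewrite scaler0 addr0 scaleN1r addNr.
  by rewrite !addr0 => ->.
have /eqP := bE j i; rewrite (negPf ij) eq_sym mulf_eq0 => /orP[]/eqP z.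
  by have /eqP := bE j j; rewrite eqxx z mul0r oner_eq0.
by have /eqP := bE i i; rewrite eqxx z mulr0 oner_eq0.
Qed.
End IsotypicCoefficients.

(** * The images of the generators in the matrix tensor product *)

Section Coproduct.
Variables (K : numFieldType) (H : polarized_hopf K) (O0 : gmod H -> Prop).
Variables (I : irreps O0) (J Jinv : bimatrix I) (tb : projections I).
Variables (E : A0_algebra H) (L : generators I E).
Hypothesis fusJ : forall W V (r s : 'I_(irr_dim W) * 'I_(irr_dim V)),
  \sum_t J r t * Jinv t s = (r == s)%:R.
Hypothesis projtb : isotypic_projections tb.
Hypothesis relE : E_relations J Jinv tb (momentl E) (momentr E) L.
Hypothesis bigrE : forall (U : I) (i j : 'I_(irr_dim U)), bigr (wt i) (wt j) (L i j).

Local Notation pure := (tpure (@MT_bal K H E E)).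

(** Since [mpure] is 0 by convention on unmatched pairs, every computation with it rests on
    matching. *)
Lemma matchedM (B C : A0_algebra H) (b b' : B) (c c' : C) :
  matched b c -> matched b' c' -> matched (b * b') (c * c').
Proof.
move=> [x [y [z [hb hc]]]] [x' [y' [z' [hb' hc']]]].
by exists (x + x'), (y + y'), (z + z'); split; exact: bigrM.
Qed.

Lemma matched_momentl f : matched (momentl E f) (1 : E).
Proof. by exists 0, 0, 0; split; [exact: momentl_bigr|exact: bigr1]. Qed.
Lemma matched_momentr f : matched (1 : E) (momentr E f).
Proof. by exists 0, 0, 0; split; [exact: bigr1|exact: momentr_bigr]. Qed.
Lemma matched_L (U : I) (i j k : 'I_(irr_dim U)) : matched (L i j) (L j k).
Proof. by exists (wt i), (wt j), (wt k); split; exact: bigrE. Qed.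

Local Hint Resolve matched_momentl matched_momentr matched_L matchedM : core.

Lemma mt_val_sum X (s : seq X) (P : pred X) (F : X -> matrix_tensor E E) :
  mt_val (\sum_(i <- s | P i) F i) = \sum_(i <- s | P i) mt_val (F i).
Proof. exact: (raddf_sum val). Qed.

Lemma mt_val_inj : injective (@mt_val K H E E).
Proof. exact: val_inj. Qed.

Lemma mt_momentl0 : mt_momentl E E 0 = 0.
Proof. by apply: mt_val_inj; rewrite mpureE // rmorph0 tpure0l. Qed.

(** Stated in the full tensor product over M_T, where no degrees have to be matched. *)
Lemma pure_moment f (b c : E) : pure (momentr E f * b) c = pure b (momentl E f * c).
Proof. by apply: (tpure_bal (phi := fun b => _ * b) (psi := fun c => _ * c)); exists f. Qed.

(** * The quadratic relation for a fixed pair W, V *)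

Section Quadratic.
Variables W V : I.
Local Notation bidx := ('I_(irr_dim W) * 'I_(irr_dim V))%type.
Local Notation coef p q r s := (isotypic_coef tb p q (r : bidx) (s : bidx)).
Variable D : seq I.
Hypothesis D_uniq : uniq D.
Hypothesis D_supp : forall U, U \notin D ->
  forall (p q : 'I_(irr_dim U)) (r s : bidx), coef p q r s = 0.

(** The element T_{rs}; the list [D] in place of Ir makes it an ordinary finite sum. *)
Definition isotypic_L (r s : bidx) : E :=
  \sum_(U <- D) \sum_(p : 'I_(irr_dim U)) \sum_q coef p q r s *: L p q.

Lemma fsum_irr (X : nmodType) (F : I -> X) : (forall U, U \notin D -> F U = 0) ->
  \sum_(U \in [set: I]) F U = \sum_(U <- D) F U.
Proof.
move=> F0; rewrite (fsbigE D) // => [|U _]; last exact: F0.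
by apply: eq_bigl => U; rewrite in_setT.
Qed.

Lemma rel_quadE (r s : bidx) : L r.2 s.2 * L r.1 s.1 =
  \sum_r' \sum_s' momentl E (Jinv r r') * momentr E (J s' s) * isotypic_L r' s'.
Proof.
rewrite (rel_quad relE) fsum_irr => [|U UD]; last first.
  do 4!(apply: big1 => ? _); rewrite D_supp // scale0r rmorph0 !mul0r //.
rewrite exchange_big; apply: eq_bigr => r' _.
rewrite exchange_big; apply: eq_bigr => s' _.
rewrite mulr_sumr; apply: eq_bigr => U _.
rewrite mulr_sumr; apply: eq_bigr => p _.
rewrite mulr_sumr; apply: eq_bigr => q _.
by rewrite linearZ -!scalerAl scalerAr.
Qed.

(** The free left factors x and y leave room for the fusion coefficients that remain outside after
    cancellation. *)
Lemma isotypic_L_comp (x y : E) (r s : bidx) :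
  \sum_t pure (x * isotypic_L r t) (y * isotypic_L t s) =
  \sum_(U <- D) \sum_(p : 'I_(irr_dim U)) \sum_q
     coef p q r s *: \sum_j pure (x * L p j) (y * L j q).
Proof.
have expand t : pure (x * isotypic_L r t) (y * isotypic_L t s) =
  \sum_(U <- D) \sum_(p : 'I_(irr_dim U)) \sum_q
  \sum_(U' <- D) \sum_(p' : 'I_(irr_dim U')) \sum_q'
    (coef p q r t * coef p' q' t s) *: pure (x * L p q) (y * L p' q').
  rewrite mulr_sumr tpure_suml; apply: eq_bigr => U _.
  rewrite mulr_sumr tpure_suml; apply: eq_bigr => p _.
  rewrite mulr_sumr tpure_suml; apply: eq_bigr => q _.
  rewrite mulr_sumr tpure_sumr; apply: eq_bigr => U' _.
  rewrite mulr_sumr tpure_sumr; apply: eq_bigr => p' _.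
  rewrite mulr_sumr tpure_sumr; apply: eq_bigr => q' _.
  by rewrite -!scalerAr tpureZl tpureZr scalerA.
under eq_bigr do rewrite expand.
rewrite exchange_big [LHS]big_seq [RHS]big_seq; apply: eq_bigr => U UD.
rewrite exchange_big; apply: eq_bigr => p _.
under [RHS]eq_bigr do rewrite scaler_sumr.
(* The column index of the first factor becomes the j of the right-hand side; then only U' = U and
   p' = j contribute. *)
rewrite exchange_big [RHS]exchange_big; apply: eq_bigr => j _ /=.
rewrite exchange_big (bigD1_seq U) //= [X in _ + X]big1 ?addr0 => [|U' U'U].
  rewrite exchange_big (bigD1 j) //= [X in _ + X]big1 ?addr0 => [|p' p'j].
    rewrite exchange_big; apply: eq_bigr => q _.
    by rewrite -scaler_suml isotypic_coefM // eqxx mul1r.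
  rewrite exchange_big; apply: big1 => q _.
  by rewrite -scaler_suml isotypic_coefM // eq_sym (negPf p'j) mul0r scale0r.
rewrite exchange_big; apply: big1 => p' _; rewrite exchange_big; apply: big1 => q _.
rewrite -scaler_suml isotypic_coef_orth ?scale0r // => UU'.
by rewrite UU' eqxx in U'U.
Qed.

Lemma fusion_cancel (x : bidx -> E) (y : bidx -> E) :
  \sum_t pure (\sum_s momentr E (J s t) * x s) (\sum_r momentl E (Jinv t r) * y r) =
  \sum_s pure (x s) (y s).
Proof.
under eq_bigr do rewrite tpure_suml.
rewrite exchange_big; apply: eq_bigr => s _ /=.
under eq_bigr do rewrite tpure_sumr.
rewrite exchange_big (bigD1 s) //= [X in _ + X]big1 ?addr0 => [|r rs].
  under eq_bigr do rewrite pure_moment mulrA -rmorphM.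
  by rewrite -tpure_sumr -mulr_suml -rmorph_sum fusJ eqxx rmorph1 mul1r.
under eq_bigr do rewrite pure_moment mulrA -rmorphM.
rewrite -tpure_sumr -mulr_suml -rmorph_sum fusJ eq_sym (negPf rs).
by rewrite rmorph0 mul0r tpure0r.
Qed.

(** The two intermediate indices merge into one index t of the basis of W ⊗ V. *)
Lemma Delta_L_mul (r s : bidx) :
  mt_val (Delta_L L r.2 s.2 * Delta_L L r.1 s.1) =
  \sum_(t : bidx) pure (L r.2 t.2 * L r.1 t.1) (L t.2 s.2 * L t.1 s.1).
Proof.
rewrite /Delta_L mulr_suml; under eq_bigr do rewrite mulr_sumr.
rewrite exchange_big pair_bigA mt_val_sum; apply: eq_bigr => t _.
by rewrite mpureM // mpureE //; exact: matchedM.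
Qed.

Lemma Delta_quad (r s : bidx) :
  Delta_L L r.2 s.2 * Delta_L L r.1 s.1 =
  \sum_(U \in [set: I]) \sum_r' \sum_s' \sum_(p : 'I_(irr_dim U)) \sum_q
    mt_momentl E E (coef p q r' s' *: Jinv r r') * mt_momentr E E (J s' s) *
    Delta_L L p q.
Proof.
rewrite fsum_irr => [|U UD]; last first.
  do 4!(apply: big1 => ? _); rewrite D_supp // scale0r mt_momentl0 !mul0r //.
apply: mt_val_inj; rewrite Delta_L_mul.
(* The shape needed for [fusion_cancel]: J(λ^2) outermost in the left factor, which uses that the
   moment maps commute, and J^{-1}(λ^1) outermost in the right one. *)
under eq_bigr => t _.
  rewrite !rel_quadE exchange_big [X in pure _ X]exchange_big /=.
  under eq_bigr => s' _.
    under eq_bigr => r' _ do rewrite (rel_comm relE) -mulrA.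
    rewrite -mulr_sumr; over.
  rewrite [X in pure _ X]exchange_big /=.
  under [X in pure _ X]eq_bigr => r' _.
    under eq_bigr => s' _ do rewrite -mulrA.
    rewrite -mulr_sumr; over.
  over.
rewrite fusion_cancel.
under eq_bigr do rewrite tpure_suml.
rewrite exchange_big mt_val_sum /=.
under [RHS]eq_bigr do rewrite mt_val_sum.
rewrite [RHS]exchange_big; apply: eq_bigr => r' _ /=.
under eq_bigr do rewrite tpure_sumr.
rewrite exchange_big /=.
under [RHS]eq_bigr do rewrite mt_val_sum.
rewrite [RHS]exchange_big; apply: eq_bigr => s' _ /=.
(* Here x is J^{-1}_{r r'}(λ^1) and y is J_{s' s}(λ^2). *)
rewrite isotypic_L_comp; apply: eq_bigr => U _.
rewrite mt_val_sum; apply: eq_bigr => p _.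
rewrite mt_val_sum; apply: eq_bigr => q _.
rewrite /Delta_L mulr_sumr mt_val_sum scaler_sumr; apply: eq_bigr => j _.
rewrite /mt_momentl /mt_momentr !mpureM ?mpureE; auto.
by rewrite mulr1 mul1r linearZ -scalerAl tpureZl.
Qed.
End Quadratic.

Lemma Delta_relations :
  E_relations J Jinv tb (@mt_momentl _ H E E) (@mt_momentr _ H E E) (Delta_L L).
Proof.
split=> //.
- by rewrite /mt_momentl rmorph1.
- by move=> f g; apply: mt_val_inj; rewrite /= !mpureE // rmorphD tpureDl.
- by move=> f g; rewrite /mt_momentl mpureM // mulr1 rmorphM.
- by rewrite /mt_momentr rmorph1.
- by move=> f g; apply: mt_val_inj; rewrite /= !mpureE // rmorphD tpureDr.
- by move=> f g; rewrite /mt_momentr mpureM // mulr1 rmorphM.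
- move=> k; apply: mt_val_inj; rewrite /= !mpureE // !linearZ !rmorph1.
  by rewrite tpureZl tpureZr.
- move=> U i j iso; rewrite /Delta_L (bigD1 i) //= big1 ?addr0.
    by rewrite !(Defs.rel_unit relE).
  by move=> k; rewrite (trivial_irr_dim k i iso) eqxx.
- by move=> f g; rewrite /mt_momentl /mt_momentr !mpureM // !mulr1 !mul1r.
(* Every first factor L^U_ik has left degree [wt i], so the shift is the same for all k; the second
   factors give the right-hand analogue. *)
- move=> f U i j; rewrite /Delta_L mulr_sumr mulr_suml; apply: eq_bigr => k _.
  by rewrite /mt_momentl !mpureM // mulr1 mul1r (rel_shiftl relE).
- move=> f U i j; rewrite /Delta_L mulr_sumr mulr_suml; apply: eq_bigr => k _.
  by rewrite /mt_momentr !mpureM // mulr1 mul1r (rel_shiftr relE).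
- move=> W V r s; have [D Du Ds] := isotypic_coef_finite projtb W V.
  exact: Delta_quad Du Ds r s.
Qed.
End Coproduct.

Theorem theorem23 (R : realType) (H : polarized_hopf (complex R))
  (nondegH : nondegenerate_hopf H) (connT : connected_points H)
  (Rm : nat -> tensC H H) (qtR : quasitriangular_structure Rm)
  (O0 : gmod H -> Prop) (abO0 : abelian_tensor_subcategory O0)
  (ssO0 : semisimple O0) (fdO0 : forall V : gmod H, O0 V -> finite_dimensional V)
  (Ir : irreps O0)
  (J Jinv : bimatrix Ir) (fusJ : fusion_matrices J Jinv)
  (tb : projections Ir) (projtb : isotypic_projections tb)
  (E : A0_algebra H) (L : generators Ir E) (hE : is_E J Jinv tb L) :
  E_relations J Jinv tb (@mt_momentl _ H E E) (@mt_momentr _ H E E) (Delta_L L).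

Proof. exact: Delta_relations (fm_inv fusJ) projtb (E_rel hE) (E_bigr hE). Qed.
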